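(* Let $d \ge 2$, let $\mu \in \mathcal{M}$ be a positive measure, and let $\lambda_1, \lambda_2 > 0$, $p \ge 1$. Then the functional $E^{\lambda_1,\lambda_2}_\mu$ has a minimizer in $\mathcal{A}$. Moreover, the image of any minimizer of $E^{\lambda_1,\lambda_2}_\mu$ in $\mathcal{A}$ is contained in the convex hull of the support of $\mu$.
   Context: $\mathcal{M}$ denotes the set of finite, compactly supported (positive) measures $\mu$ on $\mathbb{R}^d$, $d \ge 2$, with $\mu(\mathbb{R}^d) > 0$. $|\cdot|$ is the Euclidean norm. The set of curves is $\mathcal{C} := \{\gamma : [0,a] \to \mathbb{R}^d : a \ge 0,\ \gamma \text{ is Lipschitz with } |\gamma'| \le 1 \text{ Lebesgue-a.e.}\}$ ($a$ may depend on $\gamma$; $a=0$ gives a single point). The length of a curve $\gamma\in\mathcal{C}$ with domain $[0,a]$ is its total variation $\operatorname{L}(\gamma) := \sup\{\sum_{i=2}^m |\gamma(x_i)-\gamma(x_{i-1})| : 0 \le x_1 < x_2 < \dots < x_m \le a,\ m \in \mathbb{N}\}$ (an empty sum is $0$). The admissible set of multiple curves is $\mathcal{A} := \{\gamma = \{\gamma^i\}_{i=1}^{k(\gamma)} : k(\gamma) \in \mathbb{N},\ k(\gamma)\ge 1,\ \gamma^i \in \mathcal{C} \text{ for } i = 1,\dots,k(\gamma)\}$. For $\gamma \in \mathcal{A}$, $k(\gamma)$ is the number of curves, the length is $\operatorname{L}(\gamma) := \sum_{i=1}^{k(\gamma)} \operatorname{L}(\gamma^i)$, and the image $\Gamma$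 of $\gamma$ is the union of the images of the curves $\gamma^i$. The functional is $$E^{\lambda_1,\lambda_2}_\mu(\gamma) := \int_{\mathbb{R}^d} d(x,\Gamma)^p\, d\mu(x) + \lambda_1\bigl(\operatorname{L}(\gamma) + \lambda_2 (k(\gamma)-1)\bigr), \qquad \gamma \in \mathcal{A},$$ where $d(x,\Gamma)$ is the distance from $x$ to the set $\Gamma$. *)

(* Defs.v *)
From HB Require Import structures.
From mathcomp Require Export all_boot all_order all_algebra.
From mathcomp Require Export all_classical all_reals all_analysis.
Export Order.TTheory GRing.Theory Num.Theory.
Export numFieldNormedType.Exports.

Set Implicit Arguments.
Unset Strict Implicit.
Unset Printing Implicit Defensive.

Local Open Scope classical_set_scope.
Local Open Scope ring_scope.

(* The library norm `|x| on 'rV[R]_d is the max norm: it is only used for the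
   topology, every distance or length below being computed with [enorm]. *)
Definition enorm (R : realType) (d : nat) (x : 'rV[R]_d) : R :=
  Num.sqrt (\sum_(i < d) x ord0 i ^+ 2).

Notation borel_rV R d := (g_sigma_algebraType (@open 'rV[R]_d)).

Definition msupport (R : realType) (d : nat)
    (mu : set (borel_rV R d) -> \bar R) : set 'rV[R]_d :=
  [set x | forall U : set 'rV[R]_d, open U -> U x -> (0 < mu U)%E].

Definition convex_hull (R : realType) (d : nat) (A : set 'rV[R]_d) :
    set 'rV[R]_d :=
  smallest (@convex_set R 'rV[R]_d) A.

(* The values of [cfun] outside [0, cend] are irrelevant: the derivative, which
   is only constrained almost everywhere, is taken at interior points, where
   the two-sided derivative does not depend on the extension. *)
Record curve (R : realType) (d : nat) := Curve {
  cend : R;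
  cfun :> R -> 'rV[R]_d;
  cend_ge0 : 0 <= cend;
  cfun_lipschitz : exists k : R, forall s t : R,
    s \in `[0, cend] -> t \in `[0, cend] ->
    enorm (cfun s - cfun t) <= k * `|s - t|;
  cfun_speed : {ae lebesgue_measure, forall t : R,
    t \in `]0, cend[ -> derivable cfun t 1 /\ enorm (derive1 cfun t) <= 1} }.

Definition curve_image (R : realType) (d : nat) (c : curve R d) :
    set 'rV[R]_d :=
  [set c t | t in [set` `[0, cend c]]].

Definition polygonal_length (R : realType) (d : nat) (f : R -> 'rV[R]_d)
    (s : seq R) : R :=
  \sum_(0 <= i < (size s).-1) enorm (f s`_i.+1 - f s`_i).

Definition curve_length (R : realType) (d : nat) (c : curve R d) : \bar R :=
  ereal_sup [set (polygonal_length c s)%:E | s in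
    [set s : seq R | sorted <%R s /\ all [in `[0, cend c]] s]].

Record multicurve (R : realType) (d : nat) := Multicurve {
  ncurves : nat;
  component :> 'I_ncurves -> curve R d;
  ncurves_gt0 : (0 < ncurves)%N }.

Definition multicurve_length (R : realType) (d : nat) (g : multicurve R d) :
    \bar R :=
  (\sum_(i < ncurves g) curve_length (g i))%E.

Definition multicurve_image (R : realType) (d : nat) (g : multicurve R d) :
    set 'rV[R]_d :=
  \bigcup_(i in [set: 'I_(ncurves g)]) curve_image (g i).

Definition dist_to (R : realType) (d : nat) (A : set 'rV[R]_d)
    (x : 'rV[R]_d) : R :=
  inf [set enorm (x - y) | y in A].

Definition energy (R : realType) (d : nat)
    (mu : {finite_measure set (borel_rV R d) -> \bar R})
    (p lambda1 lambda2 : R) (g : multicurve R d) : \bar R :=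
  (\int[mu]_x ((dist_to (multicurve_image g) x `^ p)%:E)
   + lambda1%:E * (multicurve_length g
                   + (lambda2 * ((ncurves g)%:R - 1))%:E))%E.

Definition is_minimizer (R : realType) (d : nat)
    (mu : {finite_measure set (borel_rV R d) -> \bar R})
    (p lambda1 lambda2 : R) (g : multicurve R d) : Prop :=
  forall g' : multicurve R d,
    (energy mu p lambda1 lambda2 g <= energy mu p lambda1 lambda2 g')%E.

(* Main.v *)
(** A multicurve of finite length can be reparametrised by arc length, so that
    minimizing the energy amounts to minimizing
    [int d(x, G)^p dmu + lambda1 (sum_i L_i + lambda2 (k - 1))]
    over families of 1-Lipschitz curves [f_i] on [[0, L_i]]; conversely such a
    curve is admissible by Rademacher's theorem in dimension one.  A bound on the
    energy bounds [k] and the [L_i], truncation to a cube containing the support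
    brings the curves into a bounded set, and for fixed [k] what remains is
    compact for pointwise convergence (Tychonoff) with a lower semicontinuous
    objective.

    If a minimizer leaves the convex hull of the support, some half-space
    contains the support but not the whole image.  Projecting onto this
    half-space does not increase the distances to the support, and strictly
    shortens every component whose height above the half-space varies.  So the
    offending component has constant positive height; projecting it brings it
    strictly closer to the support, so it is a nearest component for almost no
    point, and dropping it saves at least [lambda1 lambda2] (if it is the only
    component, this is already a contradiction). *)
From HB Require Import structures.
Require Import Defs.
From mathcomp Require Import measurable_realfun ring lra.

Set Implicit Arguments.
Unset Strict Implicit.
Unset Printing Implicit Defensive.

Local Open Scope classical_set_scope.
Local Open Scope ring_scope.

(** * Euclidean norm and projections *)

Definition dot (R : realType) (d : nat) (x y : 'rV[R]_d) : R :=
  \sum_(i < d) x ord0 i * y ord0 i.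

Section EuclideanGeometry.
Context {R : realType} {d : nat}.
Implicit Types (x y z v : 'rV[R]_d) (a : R).

Lemma dotC x y : dot x y = dot y x.
Proof. by apply: eq_bigr => i _; rewrite mulrC. Qed.

Lemma dotDl x y z : dot (x + y) z = dot x z + dot y z.
Proof. by rewrite -big_split; apply: eq_bigr => i _; rewrite mxE mulrDl. Qed.

Lemma dotZl a x y : dot (a *: x) y = a * dot x y.
Proof. by rewrite mulr_sumr; apply: eq_bigr => i _; rewrite mxE mulrA. Qed.

Lemma dotBl x y z : dot (x - y) z = dot x z - dot y z.
Proof. by rewrite -scaleN1r dotDl dotZl mulN1r. Qed.

Lemma dotDr x y z : dot z (x + y) = dot z x + dot z y.
Proof. by rewrite !(dotC z) dotDl. Qed.

Lemma dotZr a x y : dot y (a *: x) = a * dot y x.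
Proof. by rewrite !(dotC y) dotZl. Qed.

Lemma dotBr x y z : dot z (x - y) = dot z x - dot z y.
Proof. by rewrite !(dotC z) dotBl. Qed.

Lemma dot_ge0 x : 0 <= dot x x.
Proof. by apply: sumr_ge0 => i _; rewrite -expr2 sqr_ge0. Qed.

Lemma enormE x : enorm x = Num.sqrt (dot x x).
Proof. by congr Num.sqrt; apply: eq_bigr => i _; rewrite expr2. Qed.

Lemma enorm_sqr x : enorm x ^+ 2 = dot x x.
Proof. by rewrite enormE sqr_sqrtr// dot_ge0. Qed.

Lemma enorm_ge0 x : 0 <= enorm x.
Proof. exact: sqrtr_ge0. Qed.

Lemma ler_enorm_sqr x a : 0 <= a -> (enorm x <= a) = (dot x x <= a ^+ 2).
Proof. by move=> a0; rewrite -enorm_sqr ler_sqr// nnegrE enorm_ge0. Qed.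

Lemma dot_eq0 x : dot x x = 0 -> x = 0.
Proof.
move=> /eqP; rewrite psumr_eq0 => [/allP x0|i _]; last by rewrite -expr2 sqr_ge0.
apply/rowP => i; rewrite mxE; apply/eqP.
by have := x0 i (mem_index_enum i); rewrite /= -expr2 sqrf_eq0.
Qed.

Lemma enorm0 : enorm (0 : 'rV[R]_d) = 0.
Proof. by rewrite -[X in enorm X](scale0r 0) enormE dotZl mul0r sqrtr0. Qed.

Lemma enorm_eq0 x : enorm x = 0 -> x = 0.
Proof. by move=> x0; apply: dot_eq0; rewrite -enorm_sqr x0 expr0n. Qed.

Lemma enormZ a x : enorm (a *: x) = `|a| * enorm x.
Proof. by rewrite !enormE dotZl dotZr mulrA -expr2 sqrtrM ?sqr_ge0// sqrtr_sqr. Qed.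

Lemma enormN x : enorm (- x) = enorm x.
Proof. by rewrite -scaleN1r enormZ normrN1 mul1r. Qed.

Lemma enorm_distC x y : enorm (x - y) = enorm (y - x).
Proof. by rewrite -enormN opprB. Qed.

(** Cauchy-Schwarz: for nonzero vectors the squared norm of [enorm y *: x - enorm x *: y] is
    [2 * (enorm x * enorm y)] times the difference of the two sides. *)
Lemma dot_le_enorm x y : dot x y <= enorm x * enorm y.
Proof.
have [/enorm_eq0 ->|y0] := eqVneq (enorm y) 0.
  by rewrite enorm0 mulr0 -(scale0r 0) dotZr mul0r.
have {y0} ye : 0 < enorm y by rewrite lt_neqAle eq_sym y0 enorm_ge0.
have [/enorm_eq0 ->|x0] := eqVneq (enorm x) 0.
  by rewrite enorm0 mul0r -(scale0r 0) dotZl mul0r.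
have {x0} xe : 0 < enorm x by rewrite lt_neqAle eq_sym x0 enorm_ge0.
have := dot_ge0 (enorm y *: x - enorm x *: y).
rewrite !(dotBl, dotBr, dotZl, dotZr) -!enorm_sqr (dotC y x) => H.
rewrite -subr_ge0 -(pmulr_rge0 _ (mulr_gt0 xe ye)).
rewrite -(pmulr_rge0 _ (ltr0n R 2)); apply: le_trans H _.
by rewrite le_eqVlt; apply/orP; left; apply/eqP; ring.
Qed.

Lemma ler_enormD x y : enorm (x + y) <= enorm x + enorm y.
Proof.
rewrite ler_enorm_sqr ?addr_ge0 ?enorm_ge0//.
rewrite dotDl !dotDr sqrrD -!enorm_sqr (dotC y x).
by have := dot_le_enorm x y; lra.
Qed.

Lemma ler_enorm_dist z x y : enorm (x - y) <= enorm (x - z) + enorm (z - y).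
Proof. by rewrite -[x - y](subrKA z); exact: ler_enormD. Qed.

Lemma ler_coord_enorm x i : `|x ord0 i| <= enorm x.
Proof.
rewrite -sqrtr_sqr; apply: ler_wsqrtr.
rewrite (bigD1 i)//= lerDl; apply: sumr_ge0 => j _; exact: sqr_ge0.
Qed.

Lemma enorm_le_coord x a : 0 <= a -> (forall i, `|x ord0 i| <= a) ->
  enorm x <= d%:R * a.
Proof.
move=> a0 xa; rewrite ler_enorm_sqr ?mulr_ge0// exprMn.
apply: (@le_trans _ _ (\sum_(i < d) a ^+ 2)).
  apply: ler_sum => i _; rewrite -expr2 -(real_normK (num_real _)).
  by rewrite lerXn2r// ?nnegrE.
rewrite sumr_const card_ord -[leLHS]mulr_natl ler_wpM2r ?sqr_ge0//.
by case: (d) => [|n]; rewrite -natrX ler_nat// expnS leq_pmulr// expn_gt0.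
Qed.

(* |py - pz|^2 + (u y - u z)^2 <= |y - z|^2 : besides being 1-Lipschitz, the
   projection [clip v b] onto {<x, v> <= b} forgets exactly the excess [over]. *)
Definition over (v : 'rV[R]_d) (b : R) (y : 'rV[R]_d) : R :=
  Num.max 0 (dot y v - b).

Definition clip (v : 'rV[R]_d) (b : R) (y : 'rV[R]_d) : 'rV[R]_d :=
  y - over v b y *: v.

Lemma clip_pythagoras v b y z : dot v v = 1 ->
  enorm (clip v b y - clip v b z) ^+ 2 + (over v b y - over v b z) ^+ 2
  <= enorm (y - z) ^+ 2.
Proof.
move=> v1; rewrite /clip.
set s := over v b y; set t := over v b z.
rewrite (_ : _ - _ - _ = (y - z) - (s - t) *: v); last first.
  by rewrite scalerBl; apply/rowP => i; rewrite !mxE; ring.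
(* The positive part is nondecreasing and 1-Lipschitz. Expanding the square of
   [(y - z) - (s - t) *: v] then leaves exactly this inequality to use. *)
have : (s - t) ^+ 2 <= (s - t) * dot (y - z) v.
  rewrite dotBl /s /t /over.
  by case: (leP 0 (dot y v - b)); case: (leP 0 (dot z v - b)) => h1 h2; nra.
rewrite !enorm_sqr; move: (y - z) => w.
by rewrite dotBl !dotBr !dotZl !dotZr v1 (dotC v); nra.
Qed.

Lemma over_eq0 v b x : dot x v <= b -> over v b x = 0.
Proof. by move=> xb; apply/max_idPl; rewrite subr_le0. Qed.

Lemma clip_id v b x : dot x v <= b -> clip v b x = x.
Proof. by move=> /over_eq0 xb; rewrite /clip xb scale0r subr0. Qed.

Lemma clip_lipschitz v b y z : dot v v = 1 ->
  enorm (clip v b y - clip v b z) <= enorm (y - z).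
Proof.
move=> v1; rewrite -ler_sqr ?nnegrE ?enorm_ge0//.
by apply: le_trans (clip_pythagoras b y z v1); rewrite lerDl sqr_ge0.
Qed.

Lemma ler_enorm_coord x y : (forall i, `|x ord0 i| <= `|y ord0 i|) ->
  enorm x <= enorm y.
Proof.
move=> xy; apply: ler_wsqrtr; apply: ler_sum => i _.
rewrite -(real_normK (num_real (x _ _))) -(real_normK (num_real (y _ _))).
by rewrite lerXn2r// ?nnegrE.
Qed.

End EuclideanGeometry.

(** * Truncation to intervals and cubes *)

Section Clamp.
Context {R : realType}.
Implicit Types a b s t M : R.

Definition clamp a b t : R := Num.max a (Num.min b t).

Lemma clamp_lipschitz a b s t : `|clamp a b s - clamp a b t| <= `|s - t|.
Proof.
rewrite /clamp.
by case: (leP b s); case: (leP b t) => h1 h2;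
   [case: (leP a b) => h3 | case: (leP a b); case: (leP a t) => h3 h4
   | case: (leP a b); case: (leP a s) => h3 h4
   | case: (leP a t); case: (leP a s) => h3 h4];
   rewrite ?subrr ?normr0 //; case: (ger0P (s - t)) => h5;
   match goal with |- context [`|?t|] => case: (ger0P t) => ? end; lra.
Qed.

Lemma clamp_itv a b t : a <= b -> clamp a b t \in `[a, b].
Proof.
by move=> ab; rewrite in_itv/= /clamp le_max lexx /= ge_max ab ge_min lexx.
Qed.

Lemma clamp_id a b t : t \in `[a, b] -> clamp a b t = t.
Proof.
by rewrite in_itv/= /clamp => /andP[h1 h2]; rewrite (min_idPr h2) (max_idPr h1).
Qed.

Lemma lipschitz_continuous (f : R -> R) (k : R) :
  (forall s t, `|f s - f t| <= k * `|s - t|) -> continuous f.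
Proof.
move=> fk x; apply/cvgrPdist_le => e e0.
have k1 : 0 < `|k| + 1 by rewrite ltr_wpDl.
near=> t; apply: le_trans (fk _ _) _.
apply: (@le_trans _ _ ((`|k| + 1) * `|x - t|)).
  by rewrite ler_wpM2r// (le_trans (ler_norm _))// lerDl.
rewrite mulrC -ler_pdivlMr//; near: t.
by apply: cvgr_dist_le; [exact: cvg_id|rewrite divr_gt0].
Unshelve. all: by end_near. Qed.

Definition cube_proj {d} M (x : 'rV[R]_d) : 'rV[R]_d :=
  \row_i clamp (- M) M (x ord0 i).

Lemma cube_proj_lipschitz d M (x y : 'rV[R]_d) :
  enorm (cube_proj M x - cube_proj M y) <= enorm (x - y).
Proof. by apply: ler_enorm_coord => i; rewrite !mxE; exact: clamp_lipschitz. Qed.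

Lemma cube_proj_id d M (x : 'rV[R]_d) :
  (forall i, `|x ord0 i| <= M) -> cube_proj M x = x.
Proof.
by move=> xM; apply/rowP => i; rewrite mxE clamp_id// in_itv/= -ler_norml.
Qed.

End Clamp.

(** * Polygonal length and arc length *)

(** Required on the whole line, so that a curve becomes a length together with a point of a fixed
    product space, whatever its domain. *)
Definition nonexpansive (R : realType) (d : nat) (f : R -> 'rV[R]_d) :=
  forall s t : R, enorm (f s - f t) <= `|s - t|.

Section PolygonalLength.
Context {R : realType} {d : nat}.
Implicit Types (f : R -> 'rV[R]_d) (l : seq R) (c : curve R d).

Lemma polygonal_length_nil f : polygonal_length f [::] = 0.
Proof. by rewrite /polygonal_length big_geq. Qed.

Lemma polygonal_length1 f x : polygonal_length f [:: x] = 0.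
Proof. by rewrite /polygonal_length big_geq. Qed.

Lemma polygonal_length_cons f x y l :
  polygonal_length f (x :: y :: l) =
  enorm (f y - f x) + polygonal_length f (y :: l).
Proof. by rewrite /polygonal_length /= big_nat_recl. Qed.

Lemma polygonal_length_ge0 f l : 0 <= polygonal_length f l.
Proof. by apply: sumr_ge0 => i _; exact: enorm_ge0. Qed.

Lemma polygonal_length_cat f l1 s l2 :
  polygonal_length f (l1 ++ s :: l2) =
  polygonal_length f (rcons l1 s) + polygonal_length f (s :: l2).
Proof.
elim: l1 => [|x [|y l1] IH]; first by rewrite polygonal_length1 add0r.
  by rewrite /= !polygonal_length_cons polygonal_length1 addr0.
by rewrite /= !polygonal_length_cons -addrA -IH.
Qed.

(** Triangle inequality in the middle of the list; at either end a nonnegative chord is added. *)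
Lemma polygonal_length_insert f l1 s l2 :
  polygonal_length f (l1 ++ l2) <= polygonal_length f (l1 ++ s :: l2).
Proof.
elim: l1 => [|x l1 IH] /=; last case: l1 IH => [_|y l1 IH] /=.
- case: l2 => [|y l2]; first by rewrite polygonal_length_nil polygonal_length_ge0.
  by rewrite polygonal_length_cons lerDr enorm_ge0.
- case: l2 => [|y l2]; first by rewrite polygonal_length1 polygonal_length_ge0.
  rewrite !polygonal_length_cons addrA lerD2r [leRHS]addrC.
  exact: ler_enorm_dist.
- by rewrite !polygonal_length_cons lerD2l.
Qed.

Lemma polygonal_length_lipschitz f k a b x l :
  (forall s t, s \in `[a, b] -> t \in `[a, b] ->
    enorm (f s - f t) <= k * `|s - t|) ->
  path <=%R x l -> all [in `[a, b]] (x :: l) ->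
  polygonal_length f (x :: l) <= k * (last x l - x).
Proof.
move=> fk; elim: l x => [|y l IH] x /=.
  by rewrite polygonal_length1 subrr mulr0.
move=> /andP[xy yl] /and3P[xab yab lab].
rewrite polygonal_length_cons.
have {IH} := IH _ yl; rewrite /= yab lab => /(_ isT) IH.
have := fk _ _ yab xab; rewrite ger0_norm ?subr_ge0//.
by lra.
Qed.

(* Repeated points do not contribute, so non-strictly sorted subdivisions, which
   are stable under insertion, give the same supremum. *)
Lemma polygonal_length_strict f x l : path <=%R x l ->
  exists l', [/\ path <%R x l', {subset l' <= l} &
    polygonal_length f (x :: l') = polygonal_length f (x :: l)].
Proof.
elim: l x => [|y l IH] x /=; first by exists [::].
move=> /andP[xy /IH[l' [yl' sub E]]].
move: xy; rewrite le_eqVlt => /predU1P[->|xy].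
  exists l'; split=> //; first by move=> z /sub; rewrite inE orbC => ->.
  by rewrite polygonal_length_cons subrr enorm0 add0r.
exists (y :: l'); split => /=; first by rewrite xy.
  by move=> z; rewrite !inE => /predU1P[->|/sub ->]; rewrite ?eqxx ?orbT.
by rewrite !polygonal_length_cons E.
Qed.

Lemma polygonal_length_le_curve_length c l :
  sorted <=%R l -> all [in `[0, cend c]] l ->
  ((polygonal_length c l)%:E <= curve_length c)%E.
Proof.
move=> sl al; apply: ereal_sup_ubound.
case: l sl al => [_ _|x l /= /(polygonal_length_strict c)[l' [xl' sub E]]].
  by exists [::].
move=> /andP[xc /allP lc]; exists (x :: l'); last by rewrite E.
by split => //=; rewrite xc; apply/allP => z /sub /lc.
Qed.

Definition variation_to f t : set R := [set polygonal_length f l | l in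
  [set l | sorted <=%R l /\ all [in `[0, t]] l]].

Lemma variation_to0 f t : variation_to f t 0.
Proof. by exists [::] => //; exact: polygonal_length_nil. Qed.

Let sortedE (r : seq R) : sorted <=%R r = pairwise <=%R r.
Proof. exact/sorted_pairwise/le_trans. Qed.

Lemma sorted_rcons_le (s : R) l : sorted <=%R l -> all (<= s) l ->
  sorted <=%R (rcons l s).
Proof. by rewrite !sortedE pairwise_rcons => -> ->. Qed.

(** Prepares the insertion of a chosen point into an arbitrary subdivision, after which the
    polygonal length splits there. *)
Lemma sorted_splitP (s : R) l : sorted <=%R l ->
  exists l1 l2, [/\ l = l1 ++ l2, all (<= s) l1, all (>= s) l2,
    sorted <=%R (rcons l1 s) & sorted <=%R (s :: l2)].
Proof.
move=> sl; suff [l1 [l2 [lE l1s l2s]]] :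
    exists l1 l2, [/\ l = l1 ++ l2, all (<= s) l1 & all (>= s) l2].
  exists l1, l2; move: sl; rewrite !sortedE lE pairwise_cat => /and3P[_ h1 h2].
  by split; rewrite // ?pairwise_rcons /= ?l1s ?l2s.
move: sl; elim: l => [|x l IH]; first by move=> _; exists [::], [::].
have [xs|sx] := leP x s => /=.
  rewrite path_sortedE; last exact: le_trans.
  move=> /andP[_ /IH[l1 [l2 [-> l1s l2s]]]].
  by exists (x :: l1), l2; rewrite /= xs.
rewrite path_sortedE; last exact: le_trans.
move=> /andP[/allP xl _]; exists [::], (x :: l); split => //=.
by rewrite (ltW sx); apply/allP => y /xl; exact/le_trans/ltW.
Qed.

End PolygonalLength.

(** * Reparametrisation by arc length *)

Section ArcLength.
Context {R : realType} {d : nat} (c : curve R d).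
Hypothesis c_rect : (curve_length c < +oo)%E.
Implicit Types (s t : R).

Let a := cend c.

Let V t : R := sup (variation_to c t).

Let curve_length_fin : curve_length c \is a fin_num.
Proof.
rewrite ge0_fin_numE//.
apply: le_trans (polygonal_length_le_curve_length (l := [::]) _ _) => //.
by rewrite polygonal_length_nil.
Qed.

Let variation_has_sup t : t <= a -> has_sup (variation_to c t).
Proof.
move=> ta; split; first by exists 0; exact: variation_to0.
exists (fine (curve_length c)) => _ [l [sl al] <-].
rewrite -lee_fin fineK//; apply: polygonal_length_le_curve_length => //.
apply/allP => x /(allP al) /=; rewrite !in_itv/= => /andP[-> xt].
exact: le_trans xt ta.
Qed.

Let V_ub t l : t <= a -> sorted <=%R l -> all [in `[0, t]] l ->
  polygonal_length c l <= V t.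
Proof.
by move=> ta sl al; apply: sup_upper_bound; [exact: variation_has_sup|exists l].
Qed.

Let all_itvW s t l : s <= t -> all [in `[0, s]] l -> all [in `[0, t]] l.
Proof.
move=> st; apply: sub_all => x /=; rewrite !in_itv/= => /andP[-> xs].
exact: le_trans xs st.
Qed.

Let chord_le_V s t : 0 <= s -> s <= t -> t <= a ->
  V s + enorm (c t - c s) <= V t.
Proof.
move=> s0 st ta; rewrite -lerBrDr; apply: ge_sup.
  by exists 0; exact: variation_to0.
move=> _ [l [sl al] <-]; rewrite lerBrDr.
have ls : all (<= s) l by apply: sub_all al => x /=; rewrite in_itv/= => /andP[].
have sls := sorted_rcons_le sl ls.
have als : all [in `[0, s]] (rcons l s).
  by rewrite all_rcons al andbT /= in_itv/= s0 lexx.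
(* Appending [s] to a subdivision of [[0, s]] loses no length, and appending [t] next adds exactly
   the chord from [s] to [t]. *)
apply: (@le_trans _ _ (polygonal_length c (l ++ [:: s; t]))).
  rewrite polygonal_length_cat polygonal_length_cons polygonal_length1 addr0.
  by rewrite lerD2r -cats1 -[X in polygonal_length _ X <= _]cats0 polygonal_length_insert.
rewrite -(cat1s s) catA !cats1; apply: V_ub => //.
  apply: sorted_rcons_le => //; rewrite all_rcons /= st /=.
  by apply: sub_all ls => x /= xs; exact: le_trans xs st.
by rewrite all_rcons (all_itvW st als) andbT /= in_itv/= (le_trans s0 st) lexx.
Qed.

(** A subdivision of [[0, t]] is cut at [s]: the first half is bounded by [V s], the second by the
    Lipschitz constant times [t - s]. *)
Let V_lip : exists2 k, 0 <= k & forall s t, 0 <= s -> s <= t -> t <= a ->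
  V t <= V s + k * (t - s).
Proof.
have [k0 ck] := cfun_lipschitz c.
(* When [a = 0] the given Lipschitz constant may be negative. *)
exists (Num.max 0 k0); first by rewrite le_max lexx.
have {}ck s t : s \in `[0, a] -> t \in `[0, a] ->
    enorm (c s - c t) <= Num.max 0 k0 * `|s - t|.
  move=> sa ta; apply: le_trans (ck _ _ sa ta) _.
  by rewrite ler_wpM2r// le_max lexx orbT.
have k_ge0 : 0 <= Num.max 0 k0 by rewrite le_max lexx.
move: (Num.max 0 k0) k_ge0 ck => k k_ge0 ck s t s0 st ta.
apply: ge_sup; first by exists 0; exact: variation_to0.
move=> _ [l [sl al] <-].
have [l1 [l2 [lE l1s l2s sl1 sl2]]] := sorted_splitP s sl.
move: al; rewrite lE all_cat => /andP[al1 al2].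
apply: le_trans (polygonal_length_insert c l1 s l2) _.
rewrite polygonal_length_cat lerD//.
  apply: V_ub => //; first exact: le_trans st ta.
  rewrite all_rcons /= in_itv/= s0 lexx /=.
  apply/allP => x xl1 /=; move: (allP l1s _ xl1) (allP al1 _ xl1).
  by rewrite /= !in_itv/= => -> /andP[->].
have al : all [in `[0, a]] (s :: l2).
  by rewrite /= (all_itvW ta al2) in_itv/= s0 (le_trans st ta).
apply: le_trans (polygonal_length_lipschitz ck sl2 al) _.
rewrite ler_wpM2l// lerD2r; case/lastP: l2 al2 {l2s sl2 al lE} => //= l2 x.
by rewrite all_rcons last_rcons /= in_itv/= => /andP[/andP[]].
Qed.

(** The new curve is [c] composed with a right inverse [tau] of the arc length [V], which exists by
    the intermediate value theorem. Since chords of [c] are bounded by increments of [V], the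
    composite is 1-Lipschitz however [tau] is chosen. *)
Lemma arc_length_param : exists (L : R) (f : R -> 'rV[R]_d),
  [/\ 0 <= L, (L%:E <= curve_length c)%E, nonexpansive f &
      f @` [set` `[0, L]] = curve_image c].
Proof.
have a0 : 0 <= a := cend_ge0 c.
have V0 : V 0 = 0.
  have [k k0 Vk] := V_lip.
  apply/eqP; rewrite eq_le; apply/andP; split.
    apply: ge_sup; first by exists 0; exact: variation_to0.
    move=> _ [l [sl al] <-]; case: l sl al => [|x l] sl al.
      by rewrite polygonal_length_nil.
    have c00 u v : u \in `[0, 0] -> v \in `[0, 0] ->
        enorm (c u - c v) <= 0 * `|u - v|.
      rewrite !in_itv/= => /le_anti <- /le_anti <-.
      by rewrite subrr enorm0 mul0r.
    by have := polygonal_length_lipschitz c00 sl al; rewrite mul0r.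
  by have := V_ub (l := [::]) a0 isT isT; rewrite polygonal_length_nil.
have V_mono s t : 0 <= s -> s <= t -> t <= a -> V s <= V t.
  move=> s0 st ta; apply: le_trans (chord_le_V s0 st ta).
  by rewrite lerDl enorm_ge0.
have V_chord s t : s \in `[0, a] -> t \in `[0, a] ->
    enorm (c s - c t) <= `|V s - V t|.
  rewrite !in_itv/= => /andP[s0 sa] /andP[t0 ta].
  have [st|/ltW ts] := leP s t.
    have := chord_le_V s0 st ta; have := V_mono _ _ s0 st ta.
    by move=> h1 h2; rewrite distrC ger0_norm ?subr_ge0// enorm_distC; lra.
  have := chord_le_V t0 ts sa; have := V_mono _ _ t0 ts sa.
  by move=> h1 h2; rewrite ger0_norm ?subr_ge0//; lra.
have V_cts : continuous (V \o clamp 0 a).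
  have [k k0 Vk] := V_lip; apply: (@lipschitz_continuous _ _ k) => s t.
  apply: le_trans (ler_wpM2l k0 (clamp_lipschitz 0 a s t)).
  rewrite [leLHS]/=.
  have := clamp_itv s a0; have := clamp_itv t a0.
  rewrite !in_itv /=; move: (clamp 0 a s) (clamp 0 a t) => {}s {}t.
  move=> /andP[t0 ta] /andP[s0 sa].
  have [st|/ltW ts] := leP s t.
    rewrite (distrC s) (distrC (V s)).
    rewrite (ger0_norm (_ : 0 <= V t - V s)) ?subr_ge0 ?V_mono//.
    by rewrite ger0_norm ?subr_ge0//; have := Vk _ _ s0 st ta; lra.
  rewrite (ger0_norm (_ : 0 <= V s - V t)) ?subr_ge0 ?V_mono//.
  by rewrite ger0_norm ?subr_ge0//; have := Vk _ _ t0 ts sa; lra.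
have VL : 0 <= V a by rewrite -V0 V_mono.
have surj s : exists t, s \in `[0, V a] -> t \in `[0, a] /\ V t = s.
  have [sL|_] := boolP (s \in `[0, V a]); last by exists 0.
  have c0 : clamp 0 a 0 = 0 by rewrite clamp_id// in_itv/= lexx a0.
  have ca : clamp 0 a a = a by rewrite clamp_id// in_itv/= a0 lexx.
  have [] := @IVT R (V \o clamp 0 a) 0 a s a0.
  - exact: continuous_subspaceT.
  - by rewrite /= c0 ca V0 (min_idPl VL) (max_idPr VL); move: sL; rewrite in_itv.
  - by move=> t tI /= Vt; exists t; rewrite tI -Vt /= clamp_id.
(* Clamping the argument to [[0, V a]] extends the composite to a nonexpansive map on the whole
   line. *)
have [tau tauP] := choice surj.
exists (V a), (fun s => c (tau (clamp 0 (V a) s))); split => //.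
- rewrite -(fineK curve_length_fin) lee_fin; apply: ge_sup.
    by exists 0; exact: variation_to0.
  move=> _ [l [sl al] <-]; rewrite -lee_fin fineK//.
  exact: polygonal_length_le_curve_length.
- move=> s t; apply: le_trans (clamp_lipschitz 0 (V a) s t).
  have [s1 s2] := tauP _ (clamp_itv s VL); have [t1 t2] := tauP _ (clamp_itv t VL).
  by apply: le_trans (V_chord _ _ s1 t1) _; rewrite s2 t2.
- apply/seteqP; split => [_ [s /= sL <-]|_ [t /= ta <-]].
    by exists (tau (clamp 0 (V a) s)) => //; have [] := tauP _ (clamp_itv s VL).
  have Vt : V t \in `[0, V a].
    by move: ta; rewrite !in_itv/= => /andP[t0 ta]; rewrite -V0 !V_mono.
  (* [tau (V t)] may differ from [t], but [V] agrees at both points, hence so does [c]. *)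
  exists (V t) => //=; rewrite clamp_id//; have [t'a Vt'] := tauP _ Vt.
  apply/eqP; rewrite -subr_eq0; apply/eqP/enorm_eq0/eqP.
  by rewrite eq_le enorm_ge0 andbT (le_trans (V_chord _ _ t'a ta))// Vt' subrr normr0.
Qed.

End ArcLength.

(** * Differentiability of Lipschitz curves *)

Section EnormContinuity.
Context {R : realType} {d : nat}.

Lemma enorm_continuous : continuous (@enorm R d).
Proof.
move=> x; apply: (@continuous_comp _ _ _
  (fun x : 'rV[R]_d => \sum_(i < d) x ord0 i ^+ 2) Num.sqrt).
  apply: continuous_big => [|i _]; first exact: add_continuous.
  move=> y; apply: (@continuous_comp _ _ _ (fun z : 'rV[R]_d => z ord0 i)
    (fun a => a ^+ 2)); first exact: coord_continuous.
  exact: exprn_continuous.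
exact: sqrt_continuous.
Qed.

End EnormContinuity.

(** * Rademacher's theorem in dimension one *)

Section LipschitzDerivable.
Context {R : realType} (f : R -> R).
Hypothesis f1 : forall s t, `|f s - f t| <= `|s - t|.

(** Adding the identity makes the function nondecreasing, so that it defines a Lebesgue-Stieltjes
    measure. *)
Let F (t : R) : R := f t + t.

Let F_nd : nondecreasing F.
Proof.
move=> s t st; have := f1 s t; rewrite distrC (ler0_norm (_ : s - t <= 0)) ?subr_le0//.
by rewrite ler_norml /F => /andP[]; lra.
Qed.

Let F_lip s t : s <= t -> F t - F s <= 2 * (t - s).
Proof.
move=> st; have := f1 t s; rewrite (ger0_norm (_ : 0 <= t - s)) ?subr_ge0//.
by rewrite ler_norml /F => /andP[]; lra.
Qed.

Let F_rc : right_continuous F.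
Proof.
apply: right_continuousW => x; apply: cvgD; last exact: cvg_id.
by apply: (@lipschitz_continuous _ f 1) => s t; rewrite mul1r.
Qed.

Let Fc : cumulative R R := HB.pack F (isCumulative.Build R _ R F F_nd F_rc).

Let nu : {measure set (measurableTypeR R) -> \bar R} := lebesgue_stieltjes_measure Fc.

Let nuE a b : a <= b -> nu `]a, b]%classic = (F b - F a)%:E.
Proof.
move=> ab; rewrite -(wlength_itv_bnd F false false)//.
exact: (@measurable_mu_extE _ R _ (wlength Fc) _ (is_ocitv a b)).
Qed.

(** Both measures are infima over covers by half-open intervals, and on each such interval the
    increment of [F] is at most twice the length. *)
Let nu_le A : ((2^-1)%:E * nu A <= lebesgue_measure A)%E.
Proof.
rewrite /lebesgue_measure /lebesgue_stieltjes_measure /measure_extension/=.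
apply: le_ereal_inf_tmp => _ [B [mB AB] <-].
have half0 : (0 <= (2^-1)%:E :> \bar R)%E by rewrite lee_fin invr_ge0.
apply: (@le_trans _ _ ((2^-1)%:E * \sum_(k <oo) wlength F (B k))%E).
  by apply: lee_wpmul2l => //; apply: ereal_inf_lbound; exists B.
rewrite -nneseriesZl => [|k _]; last exact: (wlength_ge0 Fc).
apply: lee_nneseries => [k _ _|k _].
  by rewrite mule_ge0//; exact: (wlength_ge0 Fc).
have /ocitvP[->|[[a b] /= ab ->]] := mB k; first by rewrite !wlength0 mule0.
rewrite !wlength_itv_bnd ?(ltW ab)// -EFinM lee_fin ler_pdivrMl//.
exact/F_lip/ltW.
Qed.

(** The Stieltjes measure of [F] is absolutely continuous, so [F] is an integral of its
    Radon-Nikodym density and is differentiable almost everywhere by the fundamental theorem of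
    calculus for the Lebesgue integral. *)
Lemma lipschitz_ae_derivable (L : R) :
  {ae lebesgue_measure, forall t : R, t \in `]0, L[ -> derivable f t 1}.
Proof.
have [L0|L0] := leP L 0.
  apply/aeW => t; rewrite in_itv/= => /andP[t0 tL].
  by have := lt_trans t0 (lt_le_trans tL L0); rewrite ltxx.
have mL : measurable (`]0, L]%classic : set (measurableTypeR R)) by exact: measurable_itv.
have nuL : (nu (`]0, L]%classic)%R < +oo)%E by rewrite nuE ?ltry// ltW.
(* Restricting to []0, L]] makes the measure finite, as the Radon-Nikodym theorem is applied to a
   finite measure. *)
pose nuf : {finite_measure set (measurableTypeR R) -> \bar R} := mfrestr mL nuL.
have dom : nuf `<< (@lebesgue_measure R).
  apply/null_content_dominatesP => A mA A0.
  have := nu_le A; rewrite A0 => nuA.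
  have {}nuA : nu A = 0%E.
    apply/eqP; rewrite -measure_le0 -(@lee_pmul2l _ (2^-1)%:E)// ?lte_fin ?invr_gt0//.
    by rewrite mule0.
  apply/eqP; rewrite -measure_le0 -nuA; apply: le_measure; rewrite ?inE//.
  exact: measurableI.
have [phi [phi0 phifin intphi phiE]] := radon_nikodym_sigma_finite dom.
pose g := fine \o phi.
have gE : EFin \o g = phi by apply/funext => x; rewrite /g /= fineK.
have intg : lebesgue_measure.-integrable setT (EFin \o g) by rewrite gE.
have intgy y : lebesgue_measure.-integrable
    [set` Interval (BRight 0) (BRight y)] (EFin \o g).
  by apply: integrableS intg => //; exact: measurable_itv.
have := FTC1 intgy (open_integrable_locally openT intg).
apply: filterS; first exact: (ae_filter_ringOfSetsType lebesgue_measure).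
move=> t dt; rewrite in_itv/= => /andP[t0 tL].
have [{}dt _] := dt t0.
have dF : derivable F t 1.
  pose G x := (\int[lebesgue_measure]_(t in `]0, x]) g t)%R.
  (* Only for [x] in []0, L[] does the integral of the density equal [F x - F 0], which is enough
     near the interior point [t]. *)
  apply: (@near_eq_derivable R R R (cst (F 0) + G) F t 1).
    near=> x; rewrite fctE /G.
    have x0 : 0 < x by near: x; exact: lt_nbhsr.
    have xL : x < L by near: x; exact: lt_nbhsl.
    rewrite /Rintegral.
    rewrite -[X in fine X]/(\int[lebesgue_measure]_(t in `]0%R, x]) (EFin \o g) t)%E.
    rewrite gE -phiE; last exact: measurable_itv.
    rewrite /nuf /= /mfrestr /mrestr setIidl; last first.
      by move=> y /=; rewrite !in_itv/= => /andP[-> yx]; exact: le_trans yx (ltW xL).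
    by rewrite nuE ?ltW//= addrC subrK.
  by apply: derivableD => //; exact: derivable_cst.
rewrite (_ : f = F - id); last by apply/funext => x; rewrite /F !fctE addrK.
by apply: derivableB => //; exact: derivable_id.
Unshelve. all: by end_near. Qed.

End LipschitzDerivable.

Section NonexpansiveCurve.
Context {R : realType} {d : nat}.
Implicit Types (f : R -> 'rV[R]_d) (L : R).

(** Difference quotients lie in the Euclidean unit ball, which is closed because [enorm] is
    continuous for the max-norm topology. *)
Lemma nonexpansive_derivable f t : nonexpansive f -> derivable f t 1 ->
  enorm (derive1 f t) <= 1.
Proof.
move=> f1 ft; rewrite derive1E.
have clos : closed [set x : 'rV[R]_d | enorm x <= 1].
  apply: (preimage_closed (f := @enorm R d) (D := [set r | r <= 1])).
    by move=> x _; exact: enorm_continuous.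
  exact: closed_le.
apply: (closed_cvg _ clos _ _ ft).
near=> h; rewrite /= enormZ normrV ?unitfE; last by near: h; exact: nbhs_dnbhs_neq.
rewrite ler_pdivrMl; last by rewrite normr_gt0; near: h; exact: nbhs_dnbhs_neq.
by apply: le_trans (f1 _ _) _; rewrite addrK scaler1 mulr1.
Unshelve. all: by end_near. Qed.

Lemma nonexpansive_ae_derivable f L : nonexpansive f ->
  {ae lebesgue_measure, forall t : R,
    t \in `]0, L[ -> derivable f t 1 /\ enorm (derive1 f t) <= 1}.
Proof.
move=> f1.
have aei (i : 'I_d) : {ae lebesgue_measure, forall t : R,
    t \in `]0, L[ -> derivable (fun x => f x ord0 i) t 1}.
  apply: lipschitz_ae_derivable => s t; apply: le_trans (f1 s t).
  by rewrite (le_trans _ (ler_coord_enorm _ i))// !mxE.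
have aeF : Filter (almost_everywhere (@lebesgue_measure R)).
  exact: (ae_filter_ringOfSetsType lebesgue_measure).
have : {ae lebesgue_measure, forall t : R, forall i : 'I_d,
    t \in `]0, L[ -> derivable (fun x => f x ord0 i) t 1}.
  exact: (@filter_forall _ _ _ _ aeF aei).
apply: filterS => t dt tL.
have ft : derivable f t 1.
  by apply/derivable_mxP => i j; rewrite (ord1 i); exact: dt.
by split => //; exact: nonexpansive_derivable.
Qed.

Lemma nonexpansive_curve f L : 0 <= L -> nonexpansive f ->
  exists c : curve R d, cend c = L /\ cfun c = f.
Proof.
move=> L0 f1.
have f_lip : exists k, forall s t, s \in `[0, L] -> t \in `[0, L] ->
    enorm (f s - f t) <= k * `|s - t|.
  by exists 1 => s t _ _; rewrite mul1r.
by exists (Curve L0 f_lip (nonexpansive_ae_derivable L f1)).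
Qed.

Lemma nonexpansive_curve_length (c : curve R d) : nonexpansive c ->
  (curve_length c <= (cend c)%:E)%E.
Proof.
move=> c1; apply: ge_ereal_sup => _ [l [sl al] <-]; rewrite lee_fin.
case: l sl al => [_ _|x l sl al].
  by rewrite polygonal_length_nil cend_ge0.
have c1' s t : s \in `[0, cend c] -> t \in `[0, cend c] ->
    enorm (c s - c t) <= 1 * `|s - t| by rewrite mul1r.
have xl : path <=%R x l by apply: sub_path sl => u v; exact: ltW.
apply: le_trans (polygonal_length_lipschitz c1' xl al) _; rewrite mul1r.
have := allP al _ (mem_last x l); have := allP al _ (mem_head x l).
by rewrite /= !in_itv/= => /andP[x0 _] /andP[_ lL]; lra.
Qed.

End NonexpansiveCurve.

(** * Distance to a set and fidelity term *)

Section DistanceToSet.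
Context {R : realType} {d : nat}.
Implicit Types (A B : set 'rV[R]_d) (x y : 'rV[R]_d) (r : R).

Lemma dist_to_ge0 A x : 0 <= dist_to A x.
Proof.
(* The infimum of the empty set is 0 by convention. *)
have [->|/set0P[y Ay]] := eqVneq A set0; first by rewrite /dist_to image_set0 inf0.
apply: lb_le_inf; first by exists (enorm (x - y)), y.
by move=> _ [z _ <-]; exact: enorm_ge0.
Qed.

Lemma dist_to_le A x y : A y -> dist_to A x <= enorm (x - y).
Proof.
by move=> Ay; apply: ge_inf; [exists 0 => _ [z _ <-]; exact: enorm_ge0|exists y].
Qed.

Lemma le_dist_to A x r : A !=set0 -> (forall y, A y -> r <= enorm (x - y)) ->
  r <= dist_to A x.
Proof.
move=> [y Ay] rA; apply: lb_le_inf; first by exists (enorm (x - y)), y.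
by move=> _ [z Az <-]; exact: rA.
Qed.

Lemma dist_to_lipschitz A x y : A !=set0 ->
  `|dist_to A x - dist_to A y| <= enorm (x - y).
Proof.
move=> A0.
suff H u v : dist_to A u - dist_to A v <= enorm (u - v).
  by rewrite ler_norml H andbT lerNl opprB enorm_distC H.
rewrite lerBlDl -lerBlDr; apply: le_dist_to => // z Az; rewrite lerBlDl.
exact: le_trans (dist_to_le u Az) (ler_enorm_dist v u z).
Qed.

Lemma dist_to_continuous A : A !=set0 -> continuous (dist_to A).
Proof.
move=> A0 x.
have subc : continuous (fun y : 'rV[R]_d => enorm (x - y)).
  move=> y; apply: (@continuous_comp _ _ _ (fun y => x - y) (@enorm R d)).
    by apply: continuousB; [exact: cst_continuous|move=> ?].
  exact: enorm_continuous.
apply/(@cvgrPdist_lt _ _ _ (nbhs x) (nbhs_filter x)) => e e0.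
have := subc x; rewrite /continuous_at subrr enorm0.
move=> /(@cvgrPdist_lt _ _ _ (nbhs x) (nbhs_filter x))/(_ _ e0).
apply: (@filterS _ (nbhs x)) => y /=.
rewrite sub0r normrN ger0_norm ?enorm_ge0//.
exact/le_lt_trans/dist_to_lipschitz.
Qed.

Lemma dist_to_near A B x r : A !=set0 -> B !=set0 ->
  (forall y, B y -> exists2 z, A z & enorm (z - y) <= r) ->
  dist_to A x <= dist_to B x + r.
Proof.
move=> A0 B0 BA; rewrite -lerBlDr; apply: le_dist_to => // y /BA[z Az zy].
rewrite lerBlDr; apply: le_trans (dist_to_le x Az) _.
by apply: le_trans (ler_enorm_dist y x z) _; rewrite lerD2l enorm_distC.
Qed.

End DistanceToSet.

(** * Support of the measure and the integral of the distance *)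

Section Support.
Context {R : realType} {d : nat}.
Variable mu : {finite_measure set (borel_rV R d) -> \bar R}.

Lemma open_measurable_rV (U : set 'rV[R]_d) : open U ->
  measurable (U : set (borel_rV R d)).
Proof. by move=> oU; exact: sub_sigma_algebra. Qed.

Lemma continuous_measurable_rV (f : 'rV[R]_d -> R) : continuous f ->
  measurable_fun (setT : set (borel_rV R d)) (f : borel_rV R d -> R).
Proof.
move=> /continuousP cf; apply: (measurability _ (RGenOpens.measurableE R)).
move=> _ [_ [a [b ->] <-]]; rewrite setTI; apply: open_measurable_rV.
exact/cf/interval_open.
Qed.

(* The complement of the support is covered by the countably many null balls
   with rational centre and radius. *)
Lemma ae_msupport : {ae mu, forall x, msupport mu x}.
Proof.
pose null_ball (k : nat) : set 'rV[R]_d :=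
  if unpickle k is Some (q, n) then
    let B := ball (map_mx ratr (q : 'rV[rat]_d) : 'rV[R]_d) (n.+1%:R^-1 : R) in
    if mu (B : set (borel_rV R d)) == 0%E then B else set0
  else set0.
have : mu.-negligible (\bigcup_k null_ball k).
  apply: negligible_bigcup => k; rewrite /null_ball.
  case: unpickle => [[q n]|]; last exact: negligible_set0.
  case: eqP => [B0|_]; last exact: negligible_set0.
  by apply/negligibleP => //; apply: open_measurable_rV; exact: ball_open.
apply: negligibleS => x /= /existsNP[U /not_implyP[oU /not_implyP[Ux /negP]]].
rewrite -leNgt measure_le0 => /eqP muU.
have /nbhs_ballP[e /= e0 xeU] : nbhs x U by exact: open_nbhs_nbhs.
(* Any ball of radius below [e / 2] that contains [x] lies in [U]. Balls are those of the max norm,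
   so a rational centre is found coordinate by coordinate. *)
have e2 : 0 < e / 2 by rewrite divr_gt0.
have [n _ /(_ n (leqnn n)) /= ne] := near_infty_natSinv_lt (PosNum e2).
have n0 : 0 < n.+1%:R^-1 :> R by rewrite invr_gt0.
have rat_near i : exists q : rat, `|ratr q - x ord0 i| < n.+1%:R^-1.
  have /rat_in_itvoo[q] : x ord0 i < x ord0 i + n.+1%:R^-1 by rewrite ltrDl.
  rewrite in_itv/= => /andP[h1 h2]; exists q; rewrite ltr_norml ltrBlDl h2 andbT.
  by rewrite ltrBrDr (le_lt_trans _ h1)// gerDr oppr_le0 ltW.
have {rat_near}[q qx] := choice rat_near.
pose qv : 'rV[rat]_d := \row_i q i.
pose B : set 'rV[R]_d := ball (map_mx ratr qv : 'rV[R]_d) (n.+1%:R^-1 : R).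
have Bx : B x.
  by split => // i j; rewrite (ord1 i) /ball /= !mxE; exact: qx.
have BU : B `<=` U.
  move=> y By; apply: xeU; apply: (@ball_split _ _ (map_mx ratr qv : 'rV[R]_d)).
    by apply: ball_sym; exact: le_ball (ltW ne) _ Bx.
  exact: le_ball (ltW ne) _ By.
exists (pickle (qv, n)) => //; rewrite /null_ball pickleK -/B ifT//.
rewrite -measure_le0 -muU; apply: le_measure; rewrite ?inE//.
  by apply: open_measurable_rV; exact: ball_open.
exact: open_measurable_rV.
Qed.

Let aeF : Filter (almost_everywhere mu).
Proof. exact: (ae_filter_ringOfSetsType mu). Qed.

Hypothesis mu_compact : compact (msupport mu).
Variable p : R.
Hypothesis p1 : 1 <= p.

Lemma msupport_bounded : exists2 M : R, 0 <= M &
  forall x, msupport mu x -> enorm x <= M.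
Proof.
have : compact (@enorm R d @` msupport mu).
  by apply: continuous_compact => //; exact/continuous_subspaceT/enorm_continuous.
move=> /compact_bounded[M0 [_ MK]].
exists (Num.max 0 M0 + 1); first by rewrite addr_ge0// le_max lexx.
move=> x Kx; apply: le_trans (ler_norm _) _; apply: MK; last by exists x.
by rewrite (@le_lt_trans _ _ (Num.max 0 M0))// ?le_max ?lexx ?orbT// ltrDl.
Qed.

Definition fidelity (A : set 'rV[R]_d) : \bar R :=
  (\int[mu]_x ((dist_to A x `^ p)%:E))%E.

Lemma fidelity_ge0 A : (0 <= fidelity A)%E.
Proof. by apply: integral_ge0 => x _; rewrite lee_fin powR_ge0. Qed.

Lemma measurable_dist_powR A : A !=set0 ->
  measurable_fun (setT : set (borel_rV R d)) (fun x => (dist_to A x `^ p)%:E).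
Proof.
move=> A0; apply/measurable_EFinP; apply: (measurableT_comp (measurable_powR _)).
by apply: continuous_measurable_rV; exact: dist_to_continuous.
Qed.

Lemma ae_le_fidelity A B : A !=set0 -> B !=set0 ->
  {ae mu, forall x, dist_to A x <= dist_to B x} -> (fidelity A <= fidelity B)%E.
Proof.
move=> A0 B0 AB; apply: ae_ge0_le_integral => //.
- by move=> x _; rewrite lee_fin powR_ge0.
- exact: measurable_dist_powR.
- by move=> x _; rewrite lee_fin powR_ge0.
- exact: measurable_dist_powR.
- move: AB; apply: (@filterS _ _ aeF) => x ABx _.
  rewrite lee_fin ge0_ler_powR ?nnegrE ?dist_to_ge0//.
  exact: le_trans ler01 p1.
Qed.

Lemma le_fidelity A B : A !=set0 -> B !=set0 ->
  (forall x, msupport mu x -> dist_to A x <= dist_to B x) ->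
  (fidelity A <= fidelity B)%E.
Proof.
move=> A0 B0 AB; apply: ae_le_fidelity => //.
by move: ae_msupport; apply: (@filterS _ _ aeF).
Qed.

(** Convexity on the segment from [a] to [a + 1], where [a + e] has weight [e] at the far end,
    followed by [a + 1 <= D + 1]. *)
Lemma powR_add_le (a D e : R) : 0 <= a -> a <= D -> 0 <= e -> e <= 1 ->
  (a + e) `^ p <= a `^ p + e * (D + 1) `^ p.
Proof.
move=> a0 aD e0 e1; have p0 : 0 <= p by exact: le_trans ler01 p1.
rewrite (_ : a + e = e * (a + 1) + (1 - e) * a); last by ring.
apply: (@le_trans _ _ (e * (a + 1) `^ p + (1 - e) * a `^ p)).
  by apply: (convex_powR p1 (Itv01 e0 e1)); rewrite inE/= in_itv/= ?a0 ?addr_ge0.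
have : (a + 1) `^ p <= (D + 1) `^ p.
  by rewrite ge0_ler_powR ?nnegrE ?lerD2r// addr_ge0// (le_trans a0).
move=> /(ler_wpM2l e0); have : 0 <= e * a `^ p by rewrite mulr_ge0// powR_ge0.
by lra.
Qed.

(* By convexity of [t `^ p] the error is linear in the distance [e]. *)
Lemma fidelity_near A B (D e : R) : A !=set0 -> B !=set0 -> 0 <= e -> e <= 1 ->
  (forall x, msupport mu x -> dist_to B x <= D) ->
  (forall y, B y -> exists2 z, A z & enorm (z - y) <= e) ->
  (fidelity A <= fidelity B + (e * (D + 1) `^ p)%:E * mu setT)%E.
Proof.
move=> A0 B0 e0 e1 BD BA.
have c0 : 0 <= e * (D + 1) `^ p by rewrite mulr_ge0// powR_ge0.
rewrite -integral_cst// -ge0_integralD//; last 2 first.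
  by move=> x _; rewrite lee_fin powR_ge0.
  exact: measurable_dist_powR.
apply: ae_ge0_le_integral => //.
- by move=> x _; rewrite lee_fin powR_ge0.
- exact: measurable_dist_powR.
- by move=> x _; rewrite adde_ge0// lee_fin powR_ge0.
- by apply: emeasurable_funD => //; exact: measurable_dist_powR.
- move: ae_msupport; apply: (@filterS _ _ aeF) => x Kx _; rewrite -EFinD lee_fin.
  apply: le_trans (powR_add_le (dist_to_ge0 B x) (BD _ Kx) e0 e1).
  rewrite ge0_ler_powR ?nnegrE ?addr_ge0 ?dist_to_ge0//.
    exact: le_trans ler01 p1.
  exact: dist_to_near.
Qed.

(** One point of [A] and a bound on the support dominate the integrand almost everywhere by a
    constant, and [mu] is finite. *)
Lemma fidelity_fin_num A : A !=set0 -> fidelity A \is a fin_num.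
Proof.
move=> [y Ay]; rewrite ge0_fin_numE ?fidelity_ge0//.
have [M M0 KM] := msupport_bounded.
apply: (@le_lt_trans _ _ (\int[mu]_x (((M + enorm y) `^ p)%:E))%E).
  apply: ae_ge0_le_integral => //.
  - by move=> x _; rewrite lee_fin powR_ge0.
  - by apply: measurable_dist_powR; exists y.
  - by move=> x _; rewrite lee_fin powR_ge0.
  - move: ae_msupport; apply: (@filterS _ _ aeF) => x Kx _; rewrite lee_fin.
    rewrite ge0_ler_powR ?nnegrE ?dist_to_ge0 ?addr_ge0 ?enorm_ge0//.
      exact: le_trans ler01 p1.
    apply: le_trans (dist_to_le x Ay) _; apply: le_trans (ler_enormD _ _) _.
    by rewrite enormN lerD2r KM.
rewrite integral_cst// -ge0_fin_numE; last by rewrite mule_ge0// lee_fin powR_ge0.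
by rewrite fin_numM// fin_num_measure.
Qed.

(** The difference of the powers is nonnegative almost everywhere and has zero integral, so it
    vanishes almost everywhere; the power is injective on nonnegative reals. *)
Lemma fidelity_eq_dist A B : A !=set0 -> B !=set0 ->
  (forall x, msupport mu x -> dist_to A x <= dist_to B x) ->
  (fidelity B <= fidelity A)%E ->
  {ae mu, forall x, dist_to A x = dist_to B x}.
Proof.
move=> A0 B0 AB BA.
have p0 : 0 < p by exact: lt_le_trans ltr01 p1.
have AB' x : msupport mu x -> dist_to A x `^ p <= dist_to B x `^ p.
  by move=> Kx; rewrite ge0_ler_powR ?nnegrE ?dist_to_ge0 ?AB// ltW.
pose h (x : borel_rV R d) : R := dist_to B x `^ p - dist_to A x `^ p.
have mh : measurable_fun setT (EFin \o h).
  apply/measurable_EFinP; apply: measurable_funB; apply/measurable_EFinP.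
    exact: measurable_dist_powR.
  exact: measurable_dist_powR.
(* The absolute value makes the integrand nonnegative everywhere; [h] itself is known to be so only
   on the support. *)
have split_B : fidelity B = (fidelity A + \int[mu]_x `|(h x)%:E|)%E.
  rewrite /fidelity -ge0_integralD//; last 3 first.
  - by move=> x _; rewrite lee_fin powR_ge0.
  - exact: measurable_dist_powR.
  - exact: measurableT_comp.
  apply: ge0_ae_eq_integral => //.
  - exact: measurable_dist_powR.
  - apply: emeasurable_funD; first exact: measurable_dist_powR.
    exact: measurableT_comp.
  - by move=> x _; rewrite lee_fin powR_ge0.
  - by move=> x _; rewrite adde_ge0// lee_fin powR_ge0.
  - move: ae_msupport; apply: (@filterS _ _ aeF) => x Kx _.
    by rewrite /= -EFinD ger0_norm ?subr_ge0 ?AB'// /h addrC subrK.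
have h0 : (\int[mu]_x `|(h x)%:E| = 0)%E.
  apply/eqP; rewrite eq_le integral_ge0// andbT.
  rewrite -(@leeD2lE _ (fidelity A)) ?fidelity_fin_num// adde0.
  by rewrite -split_B.
have := (ae_eq_integral_abs mu measurableT mh).1 h0.
apply: (@filterS _ _ aeF) => x /(_ I) /= [] /eqP.
rewrite subr_eq0 => /eqP hx.
by apply/esym/(powR_injective p0); rewrite ?nnegrE ?dist_to_ge0.
Qed.

(** A nonzero measure makes the almost-everywhere filter proper. *)
Lemma ae_exists (P : 'rV[R]_d -> Prop) : (0 < mu setT)%E ->
  {ae mu, forall x, P x} -> exists x, P x.
Proof.
by move=> /ae_properfilter_algebraOfSetsType aePF aeP; exact: (@filter_ex _ _ aePF _ aeP).
Qed.

End Support.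

(** * Convex hull of a compact set *)

Section ConvexHull.
Context {R : realType} {d : nat}.
Variable K : set 'rV[R]_d.

Definition simplex n : set ('I_n -> R) :=
  [set w | (forall i, 0 <= w i) /\ \sum_i w i = 1].

(** The number of points is fixed and repetitions are allowed, so that the set is a continuous image
    of a product. *)
Definition combinations n : set 'rV[R]_d :=
  [set z | exists (w : 'I_n -> R) (x : 'I_n -> 'rV[R]_d),
    [/\ simplex w, forall i, K (x i) & z = \sum_i w i *: x i]].

(* Caratheodory: an affine dependence of [d + 2] points can be subtracted from
   the weights until one of them vanishes. *)
Lemma combinations_reduce : combinations d.+2 `<=` combinations d.+1.
Proof.
move=> _ [w [x [[w0 w1] Kx ->]]].
(* The rows are the points with a coordinate 1 appended; a vector of the left kernel is an affine
   dependence. *)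
pose M : 'M[R]_(d.+2, d + 1) := row_mx (\matrix_i x i) (const_mx 1).
have : kermx M != 0.
  rewrite kermx_eq0 /row_free neq_ltn; apply/orP; left.
  by rewrite (leq_ltn_trans (rank_leq_col _))// addn1.
move=> /rowV0Pn[a /sub_kermxP aM a0].
have aX : \sum_i a ord0 i *: x i = 0.
  have /rowP aX : a *m (\matrix_i x i) = 0.
    by move: aM; rewrite mul_mx_row -row_mx0 => /eq_row_mx[].
  apply/rowP => j; have := aX j; rewrite !mxE => <-; rewrite summxE.
  by apply: eq_bigr => i _; rewrite !mxE.
have a1 : \sum_i a ord0 i = 0.
  have /rowP/(_ ord0) : a *m (const_mx 1 : 'M[R]_(d.+2, 1)) = 0.
    by move: aM; rewrite mul_mx_row -row_mx0 => /eq_row_mx[].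
  rewrite !mxE => aX1; rewrite -[RHS]aX1.
  by apply: eq_bigr => i _; rewrite mxE mulr1.
have [i0 ai0] : exists i, 0 < a ord0 i.
  apply: contrapT => /forallNP an; move/negP: a0; apply; apply/eqP/rowP => i.
  rewrite mxE; have an' j : 0 <= - a ord0 j by rewrite oppr_ge0 leNgt; exact/negP.
  have : \sum_i - a ord0 i = 0 by rewrite sumrN a1 oppr0.
  move=> /eqP; rewrite psumr_eq0 => [|j _]; last exact: an'.
  by move=> /allP/(_ i (mem_index_enum _))/=; rewrite oppr_eq0 => /eqP.
(* The least ratio over the positive coefficients is the largest multiple of [a] that can be
   subtracted while all weights stay nonnegative; the weight [k] attaining it becomes 0. *)
case: (@arg_minP _ _ _ i0 (fun i => 0 < a ord0 i) (fun i => w i / a ord0 i) ai0).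
move=> k ak kmin; set t := w k / a ord0 k in kmin.
pose w' i := w i - t * a ord0 i.
have t0 : 0 <= t by rewrite divr_ge0// ltW.
have w'0 i : 0 <= w' i.
  rewrite subr_ge0; have [ai|ai] := ltP 0 (a ord0 i).
    by rewrite -ler_pdivlMr// kmin.
  by apply: le_trans (w0 i); rewrite mulr_ge0_le0.
have w'k : w' k = 0 by rewrite /w' /t divfK ?subrr// gt_eqF.
have w'1 : \sum_i w' i = 1.
  by rewrite sumrB w1 -mulr_sumr a1 mulr0 subr0.
have w'x : \sum_i w i *: x i = \sum_i w' i *: x i.
  rewrite [RHS](eq_bigr (fun i => w i *: x i - t *: (a ord0 i *: x i))).
    by rewrite sumrB -scaler_sumr aX scaler0 subr0.
  by move=> i _; rewrite scalerBl scalerA.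
exists (fun i => w' (lift k i)), (fun i => x (lift k i)); split => //.
  by split=> [i//|]; move: w'1; rewrite (bigD1_ord k)//= w'k add0r.
by rewrite w'x (bigD1_ord k)//= w'k scale0r add0r.
Qed.

Lemma combinations_segment n z x (t : R) : 0 <= t -> t <= 1 ->
  combinations n z -> K x -> combinations n.+1 ((1 - t) *: z + t *: x).
Proof.
move=> t0 t1 [w [y [[w0 w1] Ky ->]]] Kx.
exists (fun i => if unlift ord_max i is Some j then (1 - t) * w j else t).
exists (fun i => if unlift ord_max i is Some j then y j else x).
have t1' : 0 <= 1 - t by rewrite subr_ge0.
split.
- split=> [i|]; first by case: unliftP => [j _|_] //; rewrite mulr_ge0.
  rewrite (bigD1_ord ord_max)//= unlift_none.
  under eq_bigr do rewrite liftK.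
  by rewrite -mulr_sumr w1 mulr1 addrC subrK.
- by move=> i; case: unliftP.
- rewrite (bigD1_ord ord_max)//= unlift_none addrC scaler_sumr; congr (_ + _).
  by apply: eq_bigr => i _; rewrite liftK scalerA.
Qed.

(** Induction: the last point is split off and the other weights are divided by [1 - t]. If [t = 1]
    they all vanish. *)
Lemma combinations_hull n : combinations n `<=` convex_hull K.
Proof.
elim: n => [|n IH] _ [w [x [[w0 w1] Kx ->]]].
  by move: w1; rewrite big_ord0 => /esym/eqP; rewrite oner_eq0.
move=> A [cA KA]; move: w1; rewrite !(bigD1_ord ord_max)//=.
set t := w ord_max => w1.
have sum_ge0 : 0 <= \sum_(i < n) w (lift ord_max i) by exact: sumr_ge0.
have [t1|t1] := eqVneq t 1.
  have /eqP : \sum_(i < n) w (lift ord_max i) = 0.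
    by apply: (addrI 1); rewrite addr0 -[in LHS]t1.
  rewrite psumr_eq0// => /allP wl0.
  rewrite big1 => [|i _]; last first.
    by have /eqP -> := wl0 i (mem_index_enum _); rewrite scale0r.
  by rewrite t1 scale1r addr0; exact/KA/Kx.
have tlt1 : t < 1 by rewrite lt_neqAle t1 -w1 lerDl.
have t'0 : 0 < 1 - t by rewrite subr_gt0.
have Az : A (\sum_(i < n) (w (lift ord_max i) / (1 - t)) *: x (lift ord_max i)).
  apply: (IH _ _) => //; exists (fun i => w (lift ord_max i) / (1 - t)).
  exists (fun i => x (lift ord_max i)); split => //; split=> [i|].
    by rewrite divr_ge0// ltW.
  rewrite -mulr_suml (_ : \sum_i _ = 1 - t) ?divff ?gt_eqF//.
  by rewrite -w1 addrC addrK.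
have := cA _ _ (Itv01 (w0 ord_max) (ltW tlt1)) (mem_set (KA _ (Kx ord_max))) (mem_set Az).
move=> /set_mem; congr (A _).
rewrite -[LHS]/(t *: x ord_max + (1 - t) *: _); congr (_ + _).
rewrite scaler_sumr; apply: eq_bigr => i _.
by rewrite scalerA mulrC divfK// gt_eqF.
Qed.

Lemma compact_simplex n : compact [set w : 'rV[R]_n | simplex (w ord0)].
Proof.
have cube : compact [set w : 'rV[R]_n | forall i, `[0, 1]%classic (w ord0 i)].
  exact: (@rV_compact R n (fun=> `[0, 1]%classic) (fun=> @segment_compact _ _ _)).
have sum_cts : continuous (fun w : 'rV[R]_n => \sum_i w ord0 i).
  apply: continuous_big => [|i _]; first exact: add_continuous.
  exact: coord_continuous.
have clos : closed [set w : 'rV[R]_n | \sum_i w ord0 i = 1].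
  apply: (preimage_closed (f := fun w : 'rV[R]_n => \sum_i w ord0 i)
    (D := [set r | r = 1])).
    by move=> w _; exact: sum_cts.
  exact: closed_eq.
apply: (subclosed_compact _ cube); last first.
  move=> w [w0 w1] i; rewrite /= in_itv/= w0 -w1 (bigD1 i)//= lerDl.
  by apply: sumr_ge0 => j _; exact: w0.
rewrite (_ : mkset _ = \bigcap_i [set w : 'rV[R]_n | 0 <= w ord0 i] `&`
  [set w : 'rV[R]_n | \sum_i w ord0 i = 1]).
  apply: closedI => //; apply: closed_bigI => i _.
  apply: (preimage_closed (f := fun w : 'rV[R]_n => w ord0 i) (D := [set r | 0 <= r])).
    by move=> w _; exact: coord_continuous.
  exact: closed_ge.
by apply/seteqP; split => w [w0 w1]; split => // i; [move=> _; exact: w0|exact: w0 i I].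
Qed.

Hypothesis K_compact : compact K.

(** Continuous image of the simplex times a power of [K], compact by Tychonoff. *)
Lemma compact_combinations n : compact (combinations n).
Proof.
pose P : topologicalType := prod_topology (fun _ : 'I_n => 'rV[R]_d).
pose F (q : 'rV[R]_n * P) : 'rV[R]_d :=
  \sum_i q.1 ord0 i *: (q.2 : 'I_n -> 'rV[R]_d) i.
have F_cts : continuous F.
  apply: continuous_big => [|i _]; first exact: add_continuous.
  move=> q; apply: (@continuousZ _ _ _ (fun q : 'rV[R]_n * P => q.1 ord0 i)
    (fun q : 'rV[R]_n * P => (q.2 : 'I_n -> 'rV[R]_d) i)).
    apply: (@continuous_comp _ _ _ fst (fun w : 'rV[R]_n => w ord0 i)).
      exact: cvg_fst.
    exact: coord_continuous.
  apply: (@continuous_comp _ _ _ snd (fun f : P => f i)).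
    exact: cvg_snd.
  exact: (@proj_continuous _ (fun _ : 'I_n => 'rV[R]_d) i).
have cK : compact [set f : P | forall i, K (f i)].
  exact: (@tychonoff _ (fun _ : 'I_n => 'rV[R]_d) (fun=> K) (fun=> K_compact)).
have cI := continuous_compact (continuous_subspaceT F_cts)
  (compact_setX (compact_simplex (n := n)) cK).
rewrite (_ : combinations n = F @` ([set w : 'rV[R]_n | simplex (w ord0)] `*`
  [set f : P | forall i, K (f i)]))//.
apply/seteqP; split => [_ [w [x [ws Kx ->]]]|_ [[w x] /= [ws Kx] <-]].
  exists (\row_i w i, x); last by apply: eq_bigr => i _; rewrite mxE.
  split => //=; case: ws => w0 w1; split => [i|]; first by rewrite mxE.
  by rewrite -w1; apply: eq_bigr => i _; rewrite mxE.
by exists (w ord0), x.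
Qed.

Lemma combinations1 : K `<=` combinations 1.
Proof.
move=> x Kx; exists (fun=> 1), (fun=> x); split => //.
  by split; [move=> i; exact: ler01|rewrite big_ord1].
by rewrite big_ord1 scale1r.
Qed.

Lemma combinations_neq0 n : K !=set0 -> combinations n.+1 !=set0.
Proof.
move=> [x Kx]; elim: n => [|n [z zn]]; first by exists x; exact: combinations1.
exists ((1 - 0) *: z + 0 *: x).
exact: combinations_segment.
Qed.

(** Let [w] be a point nearest to [z] among combinations of [d + 1] points. A move from [w] towards
    a point of [K] uses [d + 2] points, hence stays among these combinations after reduction;
    minimality then forces an obtuse angle, and [z - w] normalised is the required normal. *)
Lemma hull_separation (z : 'rV[R]_d) : K !=set0 -> ~ convex_hull K z ->
  exists (v : 'rV[R]_d) (b : R),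
    [/\ dot v v = 1, forall x, K x -> dot x v <= b & b < dot z v].
Proof.
move=> K0 zK.
have dist_cts : continuous (fun y : 'rV[R]_d => enorm (z - y)).
  move=> y; apply: (@continuous_comp _ _ _ (fun y : 'rV[R]_d => z - y) (@enorm R d)).
    by apply: continuousB; [exact: cst_continuous|move=> ?].
  exact: enorm_continuous.
have [w /set_mem wC wmin] := compact_EVT_min (combinations_neq0 d K0)
  (@compact_combinations d.+1) (continuous_subspaceT dist_cts).
have zw : 0 < enorm (z - w).
  rewrite lt_neqAle enorm_ge0 andbT; apply/eqP => /esym/enorm_eq0/eqP.
  rewrite subr_eq0 => /eqP zw; apply: zK; rewrite zw.
  exact: combinations_hull wC.
have obtuse x : K x -> dot (z - w) (x - w) <= 0.
  move=> Kx; rewrite leNgt; apply/negP => pos.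
  set c := dot (z - w) (x - w) in pos.
  set e := dot (x - w) (x - w).
  have e0 : 0 <= e := dot_ge0 _.
  have ec : 0 < e + c by rewrite ltr_wpDl.
  (* The squared distance changes by [t * (t * e) - 2 * (t * c)], negative as soon as [t * e <= c].
     The denominator [e + c] also gives [t <= 1] and is positive even if [e = 0]. *)
  pose t := c / (e + c).
  have t0 : 0 < t by rewrite divr_gt0.
  have t1 : t <= 1 by rewrite ler_pdivrMr// mul1r lerDr.
  have := wmin _ (mem_set (combinations_reduce
    (combinations_segment (ltW t0) t1 wC Kx))).
  apply/negP; rewrite -ltNge -ltr_sqr ?nnegrE ?enorm_ge0//.
  have -> : z - ((1 - t) *: w + t *: x) = (z - w) - t *: (x - w).
    by apply/rowP => i; rewrite !mxE; ring.
  have expand (u q : 'rV[R]_d) : dot (u - t *: q) (u - t *: q) =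
      dot u u - 2 * (t * dot u q) + t * (t * dot q q).
    by rewrite dotBl !dotBr !dotZl !dotZr (dotC q); ring.
  rewrite !enorm_sqr expand -/e -/c.
  have tE : t * e = c - t * c by rewrite /t; field; rewrite gt_eqF.
  have : t * (t * e) <= t * c.
    apply: ler_wpM2l; first exact: ltW.
    by rewrite tE gerBl mulr_ge0// ltW.
  have : 0 < t * c by rewrite mulr_gt0.
  by lra.
exists ((enorm (z - w))^-1 *: (z - w)), (dot w ((enorm (z - w))^-1 *: (z - w))).
have i0 : 0 < (enorm (z - w))^-1 by rewrite invr_gt0.
split.
- by rewrite dotZl dotZr -enorm_sqr expr2 mulKf ?mulVf// gt_eqF.
- move=> x /obtuse h; rewrite !dotZr ler_wpM2l ?(ltW i0)//.
  by rewrite -subr_le0 -dotBl dotC.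
- rewrite !dotZr -subr_gt0 -mulrBr -dotBl -enorm_sqr.
  by rewrite mulr_gt0// exprn_gt0.
Qed.

End ConvexHull.

(** * Length under projection onto a half-space, energy *)

Section ClippedLength.
Context {R : realType} {d : nat}.
Variables (v : 'rV[R]_d) (b : R) (f : R -> 'rV[R]_d).
Hypotheses (v1 : dot v v = 1) (f1 : nonexpansive f).

Lemma nonexpansive_clip : nonexpansive (clip v b \o f).
Proof. by move=> s t; apply: le_trans (clip_lipschitz b _ _ v1) (f1 s t). Qed.

(** Triangle inequality for the plane vectors [(a1, h1)] and [(a2, h2)]; Cauchy-Schwarz comes from
    Lagrange's identity. *)
Let minkowski (a1 h1 t1 a2 h2 t2 : R) : 0 <= t1 -> 0 <= t2 ->
  a1 ^+ 2 + h1 ^+ 2 <= t1 ^+ 2 -> a2 ^+ 2 + h2 ^+ 2 <= t2 ^+ 2 ->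
  (a1 + a2) ^+ 2 + (h1 + h2) ^+ 2 <= (t1 + t2) ^+ 2.
Proof.
move=> t10 t20 H1 H2.
have H : (a1 * a2 + h1 * h2) ^+ 2 <= (t1 * t2) ^+ 2.
  rewrite [leRHS]exprMn.
  apply: (@le_trans _ _ ((a1 ^+ 2 + h1 ^+ 2) * (a2 ^+ 2 + h2 ^+ 2))).
    by rewrite -subr_ge0 (_ : _ - _ = (a1 * h2 - a2 * h1) ^+ 2) ?sqr_ge0//; ring.
  by apply: ler_pM => //; rewrite addr_ge0 ?sqr_ge0.
have : a1 * a2 + h1 * h2 <= t1 * t2.
  rewrite (le_trans (ler_norm _))// -[leRHS]ger0_norm ?mulr_ge0//.
  by rewrite -ler_sqr ?nnegrE// !real_normK ?num_real.
by lra.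
Qed.

(* Minkowski's inequality, summed over the chords. *)
Lemma clipped_polygonal_length x l : path <=%R x l ->
  x <= last x l /\
  polygonal_length (clip v b \o f) (x :: l) ^+ 2
    + (over v b (f (last x l)) - over v b (f x)) ^+ 2 <= (last x l - x) ^+ 2.
Proof.
elim: l x => [|y l IH] x /=.
  by rewrite polygonal_length1 !subrr expr0n addr0.
move=> /andP[xy /IH[yl H]]; split; first exact: le_trans xy yl.
rewrite polygonal_length_cons.
have -> : over v b (f (last y l)) - over v b (f x) =
  (over v b (f y) - over v b (f x)) + (over v b (f (last y l)) - over v b (f y)).
  by ring.
have -> : last y l - x = (y - x) + (last y l - y) by ring.
apply: minkowski; rewrite ?subr_ge0// .
apply: le_trans (clip_pythagoras b _ _ v1) _.
rewrite -[leRHS]real_normK ?num_real// ler_sqr ?nnegrE ?enorm_ge0//.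
Qed.

Lemma clipped_polygonal_length_le x l : path <=%R x l ->
  polygonal_length (clip v b \o f) (x :: l) <= last x l - x.
Proof.
move=> /clipped_polygonal_length[xl H].
rewrite -ler_sqr ?nnegrE ?polygonal_length_ge0 ?subr_ge0//.
by apply: le_trans H; rewrite lerDl sqr_ge0.
Qed.

(** Insert [t1] and [t2] into any subdivision. The outer parts contribute at most [t1] and [L - t2],
    while the middle part is at most [s < D]; the gain [D - s] is the same for all subdivisions. *)
Lemma clipped_curve_length (c : curve R d) (t1 t2 : R) :
  cfun c = clip v b \o f -> 0 <= t1 -> t1 <= t2 -> t2 <= cend c ->
  over v b (f t1) != over v b (f t2) ->
  exists2 r, r < cend c & (curve_length c <= r%:E)%E.
Proof.
move=> cE t10 t12 t2L nover; set L := cend c.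
set h := over v b (f t2) - over v b (f t1).
have h2 : 0 < h ^+ 2 by rewrite exprn_even_gt0//= subr_eq0 eq_sym.
pose D := t2 - t1; pose s := Num.sqrt (D ^+ 2 - h ^+ 2).
have D0 : 0 <= D by rewrite subr_ge0.
have hD (l : seq R) (x y : R) : path <=%R x l -> last x l = y ->
    over v b (f x) = over v b (f t1) -> over v b (f y) = over v b (f t2) ->
    polygonal_length (clip v b \o f) (x :: l) ^+ 2 <= (y - x) ^+ 2 - h ^+ 2.
  move=> /clipped_polygonal_length[_ H] lE xE yE.
  by move: H; rewrite lE xE yE lerBrDr.
(* The single chord from [t1] to [t2] already shows [h ^+ 2 <= D ^+ 2]. *)
have hD0 : 0 <= D ^+ 2 - h ^+ 2.
  apply: le_trans (hD [:: t2] t1 t2 _ _ _ _) => //; first exact: sqr_ge0.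
  by rewrite /= t12.
have sD : s < D.
  by rewrite -ltr_sqr ?nnegrE ?sqrtr_ge0// sqr_sqrtr// ltrBlDr ltrDl.
exists (L - D + s); first by rewrite -addrA gtrDl addrC subr_lt0.
apply: ge_ereal_sup => _ [l [sl al] <-]; rewrite lee_fin cE.
have {}sl : sorted <=%R l by apply: sub_sorted sl => x y; exact: ltW.
have l_le x : x \in l -> 0 <= x <= L by move=> /(allP al) /=; rewrite in_itv.
have [l1 [l2 [lE _ l2t1 sl1 sl2]]] := sorted_splitP t1 sl.
have [m1 [m2 [l2E _ _ sm1 sm2]]] := sorted_splitP t2 (path_sorted sl2).
have l1E : polygonal_length (clip v b \o f) (rcons l1 t1) <= t1.
  case: l1 sl1 lE => [|x l1] sl1 lE; first by rewrite polygonal_length1.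
  have /andP[x0 _] : 0 <= x <= L by apply: l_le; rewrite lE mem_head.
  apply: le_trans (clipped_polygonal_length_le sl1) _.
  by rewrite last_rcons gerBl.
have m1E : polygonal_length (clip v b \o f) (t1 :: rcons m1 t2) <= s.
  have pm1 : path <=%R t1 (rcons m1 t2).
    rewrite path_sortedE; last exact: le_trans.
    by rewrite all_rcons t12 sm1 andbT/=; move: l2t1; rewrite l2E all_cat => /andP[].
  rewrite -ler_sqr ?nnegrE ?polygonal_length_ge0 ?sqrtr_ge0// sqr_sqrtr//.
  by apply: hD; rewrite ?last_rcons.
have m2E : polygonal_length (clip v b \o f) (t2 :: m2) <= L - t2.
  apply: le_trans (clipped_polygonal_length_le sm2) _; rewrite lerD2r.
  case/lastP: m2 l2E {sm2} => [//|m2 x] l2E; rewrite last_rcons.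
  have /andP[_] // : 0 <= x <= L.
  by apply: l_le; rewrite lE l2E !mem_cat mem_rcons mem_head !orbT.
rewrite lE; apply: le_trans (polygonal_length_insert _ l1 t1 l2) _.
rewrite polygonal_length_cat l2E -cat_cons.
have := polygonal_length_insert (clip v b \o f) (t1 :: m1) t2 m2.
rewrite polygonal_length_cat rcons_cons => H.
apply: le_trans (lerD l1E (le_trans H (lerD m1E m2E))) _.
by rewrite /D; lra.
Qed.

End ClippedLength.

(** * The energy and its real-valued counterpart *)

Section Energy.
Context {R : realType} {d : nat}.
Variable mu : {finite_measure set (borel_rV R d) -> \bar R}.
Hypothesis mu_compact : compact (msupport mu).
Variables (lambda1 lambda2 p : R).
Hypotheses (hlambda1 : 0 < lambda1) (hlambda2 : 0 < lambda2) (p1 : 1 <= p).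
Implicit Types g : multicurve R d.

Lemma curve_image_neq0 (c : curve R d) : curve_image c !=set0.
Proof. by exists (c 0), 0 => //=; rewrite in_itv/= lexx cend_ge0. Qed.

Lemma multicurve_image_neq0 g : multicurve_image g !=set0.
Proof.
have [y y0] := curve_image_neq0 (g (Ordinal (ncurves_gt0 g))).
by exists y, (Ordinal (ncurves_gt0 g)).
Qed.

(** The energy with the lengths replaced by free real numbers, so that upper and lower bounds on
    them can be inserted independently of the image. *)
Definition cost (A : set 'rV[R]_d) (k : nat) (l : 'I_k -> R) : R :=
  fine (fidelity mu p A) + lambda1 * (\sum_i l i + lambda2 * (k%:R - 1)).

Lemma curve_length_ge0 (c : curve R d) : (0 <= curve_length c)%E.
Proof.
apply: le_trans (polygonal_length_le_curve_length (l := [::]) _ _) => //.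
by rewrite polygonal_length_nil.
Qed.

Let energyE g : energy mu p lambda1 lambda2 g =
  ((fine (fidelity mu p (multicurve_image g)))%:E + lambda1%:E *
    (\sum_(i < ncurves g) curve_length (g i)
     + (lambda2 * ((ncurves g)%:R - 1))%:E))%E.
Proof. by rewrite fineK// fidelity_fin_num//; exact: multicurve_image_neq0. Qed.

Lemma energy_le_cost g (l : 'I_(ncurves g) -> R) :
  (forall i, (curve_length (g i) <= (l i)%:E)%E) ->
  (energy mu p lambda1 lambda2 g <= (cost (multicurve_image g) l)%:E)%E.
Proof.
move=> gl; rewrite energyE /cost EFinD (EFinM lambda1) (EFinD (\sum_i l i)).
apply: leeD2l.
apply: lee_wpmul2l; first by rewrite lee_fin ltW.
by apply: leeD2r; rewrite -sumEFin; apply: lee_sum.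
Qed.

Lemma cost_le_energy g (l : 'I_(ncurves g) -> R) :
  (forall i, ((l i)%:E <= curve_length (g i))%E) ->
  ((cost (multicurve_image g) l)%:E <= energy mu p lambda1 lambda2 g)%E.
Proof.
move=> gl; rewrite energyE /cost EFinD (EFinM lambda1) (EFinD (\sum_i l i)).
apply: leeD2l.
apply: lee_wpmul2l; first by rewrite lee_fin ltW.
by apply: leeD2r; rewrite -sumEFin; apply: lee_sum.
Qed.

Lemma energy_lty g i : (energy mu p lambda1 lambda2 g < +oo)%E ->
  (curve_length (g i) < +oo)%E.
Proof.
apply: contraTT; rewrite -!leNgt !leye_eq => /eqP gi.
rewrite energyE (bigD1 i)//= gi.
rewrite addye; last first.
  by rewrite -ltNye (lt_le_trans (ltNyr 0))// sume_ge0// => j _; exact: curve_length_ge0.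
by rewrite addye// gt0_muley ?lte_fin// addey.
Qed.

Lemma arc_length_components g : (energy mu p lambda1 lambda2 g < +oo)%E ->
  exists (L : 'I_(ncurves g) -> R) (f : 'I_(ncurves g) -> R -> 'rV[R]_d),
  [/\ forall i, 0 <= L i, forall i, ((L i)%:E <= curve_length (g i))%E,
      forall i, nonexpansive (f i) &
      forall i, f i @` [set` `[0, L i]] = curve_image (g i)].
Proof.
move=> fin_g.
have /choice[L] i := arc_length_param (energy_lty i fin_g).
by move=> /choice[f Lf]; exists L, f; split=> i; have [] := Lf i.
Qed.

Lemma nonexpansive_multicurve k (L : 'I_k -> R) (f : 'I_k -> R -> 'rV[R]_d) :
  (forall i, 0 <= L i) -> (forall i, nonexpansive (f i)) ->
  exists c : 'I_k -> curve R d, forall i, cend (c i) = L i /\ cfun (c i) = f i.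
Proof.
move=> L0 f1.
have cP i : exists c : curve R d, cend c = L i /\ cfun c = f i.
  exact: nonexpansive_curve.
by have [c] := choice cP; exists c.
Qed.

End Energy.

(** * Minimizers lie in the convex hull *)

Section MinimizerInHull.
Context {R : realType} {d : nat}.
Variable mu : {finite_measure set (borel_rV R d) -> \bar R}.
Hypothesis mu_compact : compact (msupport mu).
Hypothesis mu_pos : (0 < mu setT)%E.
Variables (lambda1 lambda2 p : R).
Hypotheses (hlambda1 : 0 < lambda1) (hlambda2 : 0 < lambda2) (p1 : 1 <= p).
Implicit Types g : multicurve R d.

(** The competitor is a single curve reduced to the origin. *)
Lemma minimizer_energy_lty g : is_minimizer mu p lambda1 lambda2 g ->
  (energy mu p lambda1 lambda2 g < +oo)%E.
Proof.
have f1 : nonexpansive (fun=> 0 : 'rV[R]_d).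
  by move=> s t; rewrite subrr enorm0.
have [c [cL cE]] := nonexpansive_curve (lexx 0) f1.
pose g0 := @Multicurve R d 1 (fun=> c) isT.
move=> /(_ g0)/le_lt_trans; apply.
apply: (@le_lt_trans _ _ _ _ _ _ (ltry _)).
apply: (@energy_le_cost _ _ mu mu_compact _ lambda2 _ hlambda1 p1 g0 (fun=> 0)) => i /=.
by rewrite -cL; apply: nonexpansive_curve_length; rewrite cE.
Qed.

Lemma msupport_neq0 : msupport mu !=set0.
Proof. by have [x Kx] := ae_exists mu_pos (ae_msupport mu); exists x. Qed.

Let cost_length (D D' a r S k : R) : D' <= D ->
  D + lambda1 * (a + S + k) <= D' + lambda1 * (r + S + k) -> a <= r.
Proof. by move=> DD' H; rewrite -(ler_pM2l hlambda1); lra. Qed.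

Let fine_leI (a b : \bar R) : a \is a fin_num -> b \is a fin_num ->
  fine a <= fine b -> (a <= b)%E.
Proof. by move=> fa fb; rewrite -lee_fin !fineK. Qed.

Let lerD_cancel (a b c : R) : a + c <= b + c -> a <= b.
Proof. by rewrite lerD2r. Qed.

(** Dropping a component of length [a] saves [lambda1 * (a + lambda2) > 0]; [S] is the length of the
    others. *)
Let cost_component (D D' a S k : R) : 0 <= a -> D' <= D ->
  ~~ (D + lambda1 * (a + S + lambda2 * (k - 1)) <=
     D' + lambda1 * (S + lambda2 * (k - 1 - 1))).
Proof.
move=> a0 DD'; rewrite -ltNge.
by have := mulr_gt0 hlambda1 hlambda2; have := mulr_ge0 (ltW hlambda1) a0; lra.
Qed.

Section Clip.
Variables (g : multicurve R d) (v : 'rV[R]_d) (b : R).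
Hypothesis g_min : is_minimizer mu p lambda1 lambda2 g.
Hypothesis v1 : dot v v = 1.
Hypothesis Kb : forall x, msupport mu x -> dot x v <= b.

Let G := multicurve_image g.
Let Gclip := clip v b @` G.

Let G0 : G !=set0 := multicurve_image_neq0 g.

Let Gclip0 : Gclip !=set0.
Proof. by have [y Gy] := G0; exists (clip v b y), y. Qed.

Let dist_clip x : msupport mu x -> dist_to Gclip x <= dist_to G x.
Proof.
move=> Kx; apply: le_dist_to => // y Gy.
apply: (@le_trans _ _ (enorm (x - clip v b y))).
  by apply: dist_to_le; exists y.
by rewrite -{1}(clip_id (Kb Kx)); exact: clip_lipschitz.
Qed.

(* Clipping cannot shorten a minimizer, so each component stays at a constant
   height above the half-space; then it cannot improve the distances either. *)
Let clip_minimizer :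
  (forall i y z, curve_image (g i) y -> curve_image (g i) z ->
    over v b y = over v b z) /\
  {ae mu, forall x, dist_to Gclip x = dist_to G x}.
Proof.
have g_fin := minimizer_energy_lty g_min.
have [L [f [L0 Lg f1 fg]]] := arc_length_components mu_compact hlambda1 p1 g_fin.
have cf1 i : nonexpansive (clip v b \o f i) by exact: nonexpansive_clip.
have [c cP] := nonexpansive_multicurve L0 cf1.
pose gc := Multicurve c (ncurves_gt0 g).
have gcE : multicurve_image gc = Gclip.
  apply/seteqP; split=> [_ [i _ [t /= tL <-]]|_ [y [i _ giy] <-]].
    have [cL cE] := cP i; exists (f i t); last by rewrite cE.
    by exists i => //; rewrite -fg; exists t => //=; rewrite -cL.
  move: giy; rewrite -fg => -[t tL <-]; have [cL cE] := cP i.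
  by exists i => //; exists t; rewrite /= ?cL ?cE.
have cost_le (l : 'I_(ncurves g) -> R) :
    (forall i, (curve_length (c i) <= (l i)%:E)%E) ->
    cost mu lambda1 lambda2 p G L <= cost mu lambda1 lambda2 p Gclip l.
  move=> cl; rewrite -lee_fin.
  apply: le_trans (@cost_le_energy _ _ mu mu_compact _ _ _ hlambda1 p1 g L Lg) _.
  apply: le_trans (g_min gc) _; rewrite -gcE.
  exact: (@energy_le_cost _ _ mu mu_compact _ _ _ hlambda1 p1 gc).
have fid_le : fine (fidelity mu p Gclip) <= fine (fidelity mu p G).
  apply: fine_le; [exact: fidelity_fin_num|exact: fidelity_fin_num|].
  exact: le_fidelity.
have cL i : (curve_length (c i) <= (L i)%:E)%E.
  have [cL cE] := cP i; rewrite -cL; apply: nonexpansive_curve_length.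
  by rewrite cE.
split=> [i y z|].
  rewrite -fg => -[s /= sL <-] [t tL <-]; apply/eqP; apply: contrapT => /negP.
  wlog st : s t sL tL / s <= t.
    move=> W; have [st|/ltW ts] := leP s t; first exact: W.
    by rewrite eq_sym; exact: W.
  move=> nover; have [cLi cE] := cP i.
  have [r rL rc] : exists2 r, r < cend (c i) & (curve_length (c i) <= r%:E)%E.
    move: sL tL; rewrite !in_itv/= => /andP[s0 _] /andP[_ tL].
    by apply: (clipped_curve_length v1 (f1 i) cE s0 st _ nover); rewrite cLi.
  (* Only the bound on the component of varying height is improved; the resulting comparison of
     costs gives [L i <= r], a contradiction. *)
  pose l j := if j == i then r else L j.
  have H : cost mu lambda1 lambda2 p G L <= cost mu lambda1 lambda2 p Gclip l.
    by apply: cost_le => j; rewrite /l; case: eqP => [->|_].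
  have lE : \sum_(j < ncurves g | j != i) l j = \sum_(j < ncurves g | j != i) L j.
    by apply: eq_bigr => j /negbTE; rewrite /l => ->.
  have sumE (F : 'I_(ncurves g) -> R) :
    \sum_j F j = F i + \sum_(j < ncurves g | j != i) F j by rewrite (bigD1 i).
  move: H; rewrite /cost (sumE L) (sumE l) lE /l eqxx => H.
  by have := cost_length fid_le H; rewrite leNgt -cLi rL.
apply: (fidelity_eq_dist mu_compact p1 Gclip0 G0 dist_clip).
have := cost_le L cL; rewrite /cost => H.
have {}H := lerD_cancel H.
exact: (fine_leI (fidelity_fin_num _ _ _) (fidelity_fin_num _ _ _) H).
Qed.

Lemma minimizer_below y : G y -> dot y v <= b.
Proof.
have [height distE] := clip_minimizer.
move=> [i _ giy]; rewrite leNgt; apply/negP => yb.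
pose h := over v b y.
have h0 : 0 < h by rewrite /h /over lt_max subr_gt0 yb orbT.
(* The clipped point is at distance at least [dist_to Gclip x = dist_to G x] from [x], and the
   constant excess [h] adds orthogonally. *)
have far x z : msupport mu x -> dist_to Gclip x = dist_to G x ->
    curve_image (g i) z -> Num.sqrt (dist_to G x ^+ 2 + h ^+ 2) <= enorm (x - z).
  move=> Kx xE giz; rewrite -(ger0_norm (enorm_ge0 (x - z))) -sqrtr_sqr.
  apply: ler_wsqrtr; apply: le_trans _ (clip_pythagoras b x z v1).
  rewrite (over_eq0 (Kb Kx)) sub0r (sqrrN (over _ _ _)) -(height i y z giy giz).
  rewrite lerD2r (clip_id (Kb Kx)) ler_sqr ?nnegrE ?dist_to_ge0 ?enorm_ge0// -xE.
  by apply: dist_to_le; exists z => //; exists i.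
have closer x : dist_to G x < Num.sqrt (dist_to G x ^+ 2 + h ^+ 2).
  rewrite -ltr_sqr ?nnegrE ?dist_to_ge0 ?sqrtr_ge0// sqr_sqrtr.
    by rewrite ltrDl exprn_gt0.
  by rewrite addr_ge0 ?sqr_ge0.
have aeKE : {ae mu, forall x, msupport mu x /\ dist_to Gclip x = dist_to G x}.
  have aeF : Filter (almost_everywhere mu) := ae_filter_ringOfSetsType mu.
  exact: (@filterI _ _ aeF _ _ (ae_msupport mu) distE).
(* With one component, every point of [G] would be farther from [x] than the distance to [G]. *)
have [k1|k1] := leqP (ncurves g) 1.
  have [x [Kx xE]] := ae_exists mu_pos aeKE.
  have := closer x; rewrite ltNge => /negP; apply; apply: le_dist_to => //.
  move=> z [j _ gjz]; apply: far => //.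
  suff -> : i = j by [].
  apply: val_inj => /=; move: (leq_trans (ltn_ord i) k1) (leq_trans (ltn_ord j) k1).
  by rewrite !ltnS !leqn0 => /eqP -> /eqP ->.
have k0 : (0 < (ncurves g).-1)%N by rewrite -subn1 subn_gt0.
pose g' := @Multicurve R d _ (fun j => g (lift i j)) k0.
pose G' := multicurve_image g'.
have G'0 : G' !=set0 := multicurve_image_neq0 g'.
have dist' : {ae mu, forall x, dist_to G' x <= dist_to G x}.
  have aeF : Filter (almost_everywhere mu) := ae_filter_ringOfSetsType mu.
  move: aeKE; apply: (@filterS _ _ aeF) => x [Kx xE].
  rewrite leNgt; apply/negP => lt'.
  (* Were [G'] strictly farther from [x] than [G], all points of [G] would be at distance at least
     [r], which exceeds [dist_to G x]. *)
  pose r := Num.min (dist_to G' x) (Num.sqrt (dist_to G x ^+ 2 + h ^+ 2)).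
  have : dist_to G x < r by rewrite lt_min lt' closer.
  rewrite ltNge => /negP; apply; apply: le_dist_to => // z [j _ gjz].
  rewrite ge_min; have [jE|] := unliftP i j.
    by move=> jj; apply/orP; left; apply: dist_to_le; exists jE => //=; rewrite -jj.
  by move=> ji; rewrite (far x z) ?orbT// -ji.
have g_fin := minimizer_energy_lty g_min.
pose l j := fine (curve_length (g j)).
have lE j : (l j)%:E = curve_length (g j).
  rewrite fineK// ge0_fin_numE ?curve_length_ge0//.
  by apply: energy_lty g_fin.
have cost_lel : cost mu lambda1 lambda2 p G l <=
    cost mu lambda1 lambda2 p G' (fun j => l (lift i j)).
  rewrite -lee_fin.
  apply: le_trans (@cost_le_energy _ _ mu mu_compact _ _ _ hlambda1 p1 g l _) _.
    by move=> j; rewrite lE.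
  apply: le_trans (g_min g') _.
  apply: (@energy_le_cost _ _ mu mu_compact _ _ _ hlambda1 p1 g') => j.
  by rewrite lE.
have fid_le : fine (fidelity mu p G') <= fine (fidelity mu p G).
  apply: fine_le; [exact: fidelity_fin_num|exact: fidelity_fin_num|].
  exact: ae_le_fidelity.
have l0 : 0 <= l i by apply: fine_ge0; exact: curve_length_ge0.
move: cost_lel; rewrite /cost (bigD1_ord i)//=.
have -> : (ncurves g).-1%:R = (ncurves g)%:R - 1 :> R.
  by rewrite -subn1 natrB// ltnW.
exact/negP/cost_component.
Qed.

End Clip.

Lemma minimizer_sub_hull g : is_minimizer mu p lambda1 lambda2 g ->
  multicurve_image g `<=` convex_hull (msupport mu).
Proof.
move=> g_min y Gy; apply: contrapT => yK.
have [v [b [v1 Kb]]] := hull_separation mu_compact msupport_neq0 yK.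
by rewrite ltNge (minimizer_below g_min v1 Kb Gy).
Qed.

End MinimizerInHull.

(** * Compactness of families of curves *)

(** Without a minimum, the sublevel sets have a cluster point [x] in [A]. Some [y] has a smaller
    value, and semicontinuity at [x] with half the gap contradicts that the sublevel set of [y]
    accumulates at [x]. *)
Lemma compact_lsc_min (T : topologicalType) (R : realType) (A : set T)
    (F : T -> R) : A !=set0 -> compact A ->
  (forall x e, A x -> 0 < e -> \forall y \near x, A y -> F x <= F y + e) ->
  exists2 x, A x & forall y, A y -> F x <= F y.
Proof.
move=> [a Aa] cA lscF; apply: contrapT => nomin.
have smaller x : A x -> exists2 y, A y & F y < F x.
  move=> Ax; apply: contrapT => H; apply: nomin; exists x => // y Ay.
  by rewrite leNgt; apply/negP => yx; apply: H; exists y.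
pose sub a := [set z | A z /\ F z <= F a].
have sub_filter : ProperFilter (filter_from A sub).
  apply: filter_from_proper; last by move=> x Ax; exists x; split.
  apply: filter_from_filter; first by exists a.
  move=> x y Ax Ay; have [xy|/ltW yx] := leP (F x) (F y).
    by exists x => // z [Az zx]; split; split=> //; exact: le_trans zx xy.
  by exists y => // z [Az zy]; split; split=> //; exact: le_trans zy yx.
have [x [Ax clx]] : A `&` cluster (filter_from A sub) !=set0.
  by apply: cA; exists a => // z [].
have [y Ay yx] := smaller x Ax.
have e0 : 0 < (F x - F y) / 2 by rewrite divr_gt0// subr_gt0.
have [|z [[Az zy] /(_ Az)]] := clx (sub y) _ _ (lscF x _ Ax e0).
  by exists y.
by lra.
Qed.

Section CurveCompactness.
Context {R : realType} {d : nat}.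
Variables (M lmax : R).
Hypotheses (M0 : 0 <= M) (lmax0 : 0 <= lmax).

Local Notation V := 'rV[R]_d.

Definition in_cube (x : V) := forall i, `|x ord0 i| <= M.

Let Y : topologicalType := prod_topology (fun _ : R => V).

Lemma compact_cube : compact [set x : V | in_cube x].
Proof.
rewrite (_ : mkset _ = [set x : V | forall i, `[- M, M]%classic (x ord0 i)]).
  exact: (@rV_compact R d (fun=> `[- M, M]%classic) (fun=> @segment_compact _ _ _)).
by apply/seteqP; split=> x xM i; have := xM i; rewrite /= in_itv/= ler_norml.
Qed.

Let Lip : set Y := [set f | nonexpansive (f : R -> V) /\ forall t, in_cube (f t)].

Let eval_continuous (t : R) : continuous (fun f : Y => (f : R -> V) t).
Proof. exact: (@proj_continuous _ (fun _ : R => V) t). Qed.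

(** A closed subset of a product of cubes: nonexpansiveness is a closed condition on each pair of
    evaluations. *)
Let compact_Lip : compact Lip.
Proof.
have cube : compact [set f : Y | forall t, in_cube ((f : R -> V) t)].
  exact: (@tychonoff _ (fun _ : R => V) (fun=> [set x | in_cube x])
    (fun=> compact_cube)).
apply: (subclosed_compact _ cube); last by move=> f [].
rewrite (_ : Lip = [set f : Y | forall t, in_cube ((f : R -> V) t)] `&`
    \bigcap_(st in [set: R * R]) [set f : Y |
      enorm ((f : R -> V) st.1 - (f : R -> V) st.2) <= `|st.1 - st.2|]).
  apply: closedI.
    rewrite (_ : mkset _ = \bigcap_(t in [set: R]) \bigcap_(i in [set: 'I_d])
        [set f : Y | `|(f : R -> V) t ord0 i| <= M]); last first.
      by apply/seteqP; split=> f fM t; [move=> _ i _; exact: fM|move=> i; exact: fM].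
    apply: closed_bigI => t _; apply: closed_bigI => i _.
    apply: (preimage_closed (f := fun f : Y => `|(f : R -> V) t ord0 i|)
      (D := [set r | r <= M])); last exact: closed_le.
    move=> f _; apply: (@continuous_comp _ _ _ (fun f : Y => (f : R -> V) t ord0 i)
      (fun r : R => `|r|)); last exact: norm_continuous.
    apply: (@continuous_comp _ _ _ (fun f : Y => (f : R -> V) t)
      (fun x : V => x ord0 i)); last exact: coord_continuous.
    exact: eval_continuous.
  apply: closed_bigI => -[s t] _ /=.
  apply: (preimage_closed (f := fun f : Y => enorm ((f : R -> V) s - (f : R -> V) t))
    (D := [set r | r <= `|s - t|])); last exact: closed_le.
  move=> f _; apply: (@continuous_comp _ _ _
    (fun f : Y => (f : R -> V) s - (f : R -> V) t) (@enorm R d)).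
    by apply: continuousB; exact: eval_continuous.
  exact: enorm_continuous.
apply/seteqP; split=> f.
  by move=> [f1 fM]; split => // -[s t] _; exact: f1.
by move=> [fM f1]; split => // s t; exact: (f1 (s, t)).
Qed.

Definition tracks k (L : 'I_k -> R) (f : 'I_k -> R -> V) : set V :=
  \bigcup_(i in [set: 'I_k]) (f i @` [set` `[0, L i]]).

(* The topology is that of pointwise convergence; on nonexpansive curves with
   bounded domains it controls the images uniformly. *)
Definition curve_space : topologicalType := (R * Y)%type.

Definition family_space k : topologicalType :=
  prod_topology (fun _ : 'I_k => curve_space).

Definition admissible k : set (family_space k) :=
  [set q | forall i : 'I_k, [/\ (q i).1 \in `[0, lmax],
    nonexpansive ((q i).2 : R -> V) & forall t, in_cube (((q i).2 : R -> V) t)]].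

Lemma compact_admissible k : compact (@admissible k).
Proof.
have := @tychonoff _ (fun _ : 'I_k => curve_space)
  (fun=> [set` `[0, lmax]] `*` Lip)
  (fun=> compact_setX (@segment_compact _ _ _) compact_Lip).
congr compact; apply/seteqP; split=> q qP i; have := qP i.
  by move=> [/= h1 [h2 h3]].
by move=> [h1 h2 h3].
Qed.

(** Nonexpansive curves that are close on the grid of multiples of [e] up to [lmax] are close
    everywhere. The constant 4 counts two steps from [s] through [t] to the grid point, one between
    the curves, and one back to [t]. This one-sided closeness is what lower semicontinuity uses. *)
Lemma admissible_close k (q : family_space k) (e : R) : admissible q -> 0 < e ->
  \forall q' \near q, admissible q' ->
    (forall i : 'I_k, (q i).1 <= (q' i).1 + e) /\
    forall y, tracks (fun i => (q' i).1) (fun i => (q' i).2) y ->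
    exists2 z, tracks (fun i => (q i).1) (fun i => (q i).2) z &
      enorm (z - y) <= 4 * e.
Proof.
move=> qP e0.
have [N lN] : exists N : nat, lmax <= N%:R * e.
  exists (Num.bound (lmax / e)); rewrite -ler_pdivrMr// ltW//.
  by apply: archi_boundP; rewrite divr_ge0// ltW.
have qF : Filter (nbhs q) := nbhs_filter q.
have near_len (i : 'I_k) : \forall q' \near q, `|(q i).1 - (q' i).1| < e.
  have cts : continuous (fun q' : family_space k => (q' i).1).
    move=> q'; apply: (@continuous_comp _ _ _ (fun q' : family_space k => q' i)
      (fun c : curve_space => c.1)); last exact: cvg_fst.
    exact: (@proj_continuous _ (fun _ : 'I_k => curve_space) i).
  by have /cvgrPdist_lt := cts q; apply.
have near_pt (i : 'I_k) (j : 'I_N.+1) : \forall q' \near q,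
    enorm (((q i).2 : R -> V) (j%:R * e) - ((q' i).2 : R -> V) (j%:R * e)) < e.
  pose x := ((q i).2 : R -> V) (j%:R * e).
  have cts : continuous (fun q' : family_space k =>
      enorm (x - ((q' i).2 : R -> V) (j%:R * e))).
    move=> q'.
    apply: (@continuous_comp _ _ _ (fun q' : family_space k =>
      ((q' i).2 : R -> V) (j%:R * e)) (fun y : V => enorm (x - y))).
      apply: (@continuous_comp _ _ _ (fun q' : family_space k => (q' i).2)
        (fun f : Y => (f : R -> V) (j%:R * e))); last exact: eval_continuous.
      apply: (@continuous_comp _ _ _ (fun q' : family_space k => q' i)
        (fun c : curve_space => c.2)); last exact: cvg_snd.
      exact: (@proj_continuous _ (fun _ : 'I_k => curve_space) i).
    apply: (@continuous_comp _ _ _ (fun y : V => x - y) (@enorm R d)).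
      by apply: continuousB; [exact: cst_continuous|move=> ?].
    exact: enorm_continuous.
  have := cts q; rewrite /continuous_at subrr enorm0 => /cvgrPdist_lt/(_ _ e0).
  by apply: (@filterS _ _ qF) => q'; rewrite sub0r normrN ger0_norm ?enorm_ge0.
have near_pts (i : 'I_k) : \forall q' \near q, forall j : 'I_N.+1,
    enorm (((q i).2 : R -> V) (j%:R * e) - ((q' i).2 : R -> V) (j%:R * e)) < e.
  by apply: (@filter_forall _ _ _ _ qF) => j; exact: near_pt.
have near_all : \forall q' \near q, forall i : 'I_k,
    `|(q i).1 - (q' i).1| < e /\ forall j : 'I_N.+1,
    enorm (((q i).2 : R -> V) (j%:R * e) - ((q' i).2 : R -> V) (j%:R * e)) < e.
  by apply: (@filter_forall _ _ _ _ qF) => i;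
     apply: (@filterI _ _ qF); [exact: near_len|exact: near_pts].
move: near_all; apply: (@filterS _ _ qF) => q' close q'P; split=> [i|].
  have [/ltW + _] := close i; rewrite ler_distlC => /andP[h _].
  by rewrite -lerBlDr.
move=> _ [i _ [t /= tL <-]].
have [qL q1 _] := qP i; have [q'L q'1 _] := q'P i.
move: tL qL q'L; rewrite !in_itv/= => /andP[t0 tL] /andP[L0 LM] /andP[L'0 L'M].
have [dL dP] := close i.
(* [t] may exceed the length of the [i]-th curve of [q], but by less than [e]. *)
pose s := Num.min t (q i).1.
have st : `|s - t| <= e.
  rewrite /s; have [_|Lt] := leP t (q i).1; first by rewrite subrr normr0 ltW.
  rewrite distrC ger0_norm ?subr_ge0 ?ltW//; move: dL.
  rewrite distrC => dL; rewrite (le_lt_trans _ dL)//.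
  by rewrite (le_trans _ (ler_norm _))// lerD2r.
exists (((q i).2 : R -> V) s).
  by exists i => //; exists s => //=; rewrite in_itv/= /s le_min t0 L0 ge_min lexx orbT.
have te0 : 0 <= t / e by rewrite divr_ge0// ltW.
have te := truncn_itv te0.
set j := Num.truncn (t / e) in te.
have jN : (j < N.+1)%N.
  rewrite ltnS -(ler_nat R); apply: (@le_trans _ _ (t / e)); first by case/andP: te.
  by rewrite ler_pdivrMr// (le_trans tL)// (le_trans L'M).
have tj : `|t - j%:R * e| <= e.
  move: te; rewrite ler_pdivlMr// ltr_pdivrMr// -addn1 natrD mulrDl mul1r => /andP[h1 h2].
  by rewrite ger0_norm ?subr_ge0// lerBlDl ltW.
have := dP (Ordinal jN) => /=.
set u := j%:R * e in tj *; move=> pj.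
apply: le_trans (ler_enorm_dist (((q i).2 : R -> V) u) _ _) _.
have h1 : enorm (((q i).2 : R -> V) s - ((q i).2 : R -> V) u) <= 2 * e.
  apply: le_trans (q1 _ _) _; apply: le_trans (ler_distD t _ _) _.
  by apply: le_trans (lerD st tj) _; lra.
have h2 : enorm (((q i).2 : R -> V) u - ((q' i).2 : R -> V) t) <= 2 * e.
  apply: le_trans (ler_enorm_dist (((q' i).2 : R -> V) u) _ _) _.
  have := q'1 u t; rewrite distrC => h; have := le_trans h tj.
  by lra.
by apply: le_trans (lerD h1 h2) _; lra.
Qed.

End CurveCompactness.

(** * Existence of a minimizer *)

Section Existence.
Context {R : realType} {d : nat}.
Variable mu : {finite_measure set (borel_rV R d) -> \bar R}.
Hypothesis mu_compact : compact (msupport mu).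
Variables (lambda1 lambda2 p : R).
Hypotheses (hlambda1 : 0 < lambda1) (hlambda2 : 0 < lambda2) (p1 : 1 <= p).
Implicit Types (g : multicurve R d) (A B : set 'rV[R]_d).

Let fid A : R := fine (fidelity mu p A).

Let fid_ge0 A : 0 <= fid A.
Proof. by apply: fine_ge0; exact: fidelity_ge0. Qed.

Let fid_near A B (D e : R) : A !=set0 -> B !=set0 -> 0 <= e -> e <= 1 ->
  (forall x, msupport mu x -> dist_to B x <= D) ->
  (forall y, B y -> exists2 z, A z & enorm (z - y) <= e) ->
  fid A <= fid B + e * ((D + 1) `^ p * fine (mu setT)).
Proof.
move=> A0 B0 e0 e1 BD BA.
have muT : mu setT \is a fin_num by exact: fin_num_measure.
have := fidelity_near p1 A0 B0 e0 e1 BD BA.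
rewrite -[X in (X <= _)%E](fineK (fidelity_fin_num mu_compact p1 A0)).
rewrite -[X in (_ <= X + _)%E](fineK (fidelity_fin_num mu_compact p1 B0)).
by rewrite -[X in (_ <= _ + _ * X)%E](fineK muT) -EFinM -EFinD lee_fin mulrA.
Qed.

Let cost_step (a b s s' h C n c e : R) :
  a <= b + 4 * h * C -> s <= s' + n * h -> h * (4 * C + lambda1 * n) <= e ->
  a + lambda1 * (s + c) <= b + lambda1 * (s' + c) + e.
Proof.
move=> H1 H2 H3.
have H4 : lambda1 * s <= lambda1 * (s' + n * h) by rewrite ler_pM2l.
by lra.
Qed.

Let cost_bounds (a S m e : R) : 0 <= a -> 0 <= S -> 0 <= m ->
  a + lambda1 * (S + lambda2 * m) <= e ->
  lambda1 * S <= e /\ lambda1 * lambda2 * m <= e.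
Proof.
move=> a0 S0 m0; have := mulr_ge0 (ltW hlambda1) S0.
by have := mulr_ge0 (mulr_ge0 (ltW hlambda1) (ltW hlambda2)) m0; lra.
Qed.

Let lerD2r_imply (a b c : R) : a <= b -> a + c <= b + c.
Proof. by rewrite lerD2r. Qed.

Lemma tracks_neq0 k (L : 'I_k.+1 -> R) (f : 'I_k.+1 -> R -> 'rV[R]_d) :
  (forall i, 0 <= L i) -> tracks L f !=set0.
Proof.
move=> L0; exists (f ord0 0); exists ord0 => //; exists 0 => //=.
by rewrite in_itv/= lexx L0.
Qed.

(* By arc length, nothing is lost in letting the multicurve compete with all
   nonexpansive families. *)
Lemma fixed_number_minimum (M lmax : R) (k : nat) :
  0 <= M -> 0 <= lmax -> (forall x, msupport mu x -> enorm x <= M) ->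
  exists r : R,
    (exists g, (energy mu p lambda1 lambda2 g <= r%:E)%E) /\
    forall (L : 'I_k.+1 -> R) (f : 'I_k.+1 -> R -> 'rV[R]_d),
      (forall i, L i \in `[0, lmax]) -> (forall i, nonexpansive (f i)) ->
      (forall i t, in_cube M (f i t)) ->
      r <= cost mu lambda1 lambda2 p (tracks L f) L.
Proof.
move=> M0 lmax0 KM.
pose F (q : @family_space R d k.+1) : R :=
  cost mu lambda1 lambda2 p (tracks (fun i => (q i).1) (fun i => (q i).2))
    (fun i => (q i).1).
(* Bounds the distance between a point of the support and a point of the cube. *)
pose D := M + d%:R * M.
pose C := (D + 1) `^ p * fine (mu setT).
have C0 : 0 <= C by rewrite mulr_ge0 ?powR_ge0// fine_ge0.
have adm_neq0 (q : @family_space R d k.+1) : admissible M lmax q ->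
    tracks (fun i => (q i).1) (fun i => (q i).2) !=set0.
  move=> qP; apply: tracks_neq0 => i.
  by have [] := qP i; rewrite in_itv/= => /andP[].
have adm_dist (q : @family_space R d k.+1) : admissible M lmax q ->
    forall x, msupport mu x ->
      dist_to (tracks (fun i => (q i).1) (fun i => (q i).2)) x <= D.
  move=> qP x Kx; have [y qy] := adm_neq0 q qP.
  apply: le_trans (dist_to_le x qy) _; apply: le_trans (ler_enormD _ _) _.
  rewrite enormN lerD ?KM//; apply: enorm_le_coord => // j.
  by case: qy => i _ [t _ <-]; have [_ _] := qP i; apply.
have F_lsc q e : admissible M lmax q -> 0 < e ->
    \forall q' \near q, admissible M lmax q' -> F q <= F q' + e.
  move=> qP e0.
  (* The cost varies by at most [h * N]: points move by [4 * h] and each of the [k + 1] lengths by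
     [h]. The choice of [h] also ensures [4 * h <= 1] for [fid_near], and [N + 1] avoids dividing by
     0. *)
  pose N := 4 * C + lambda1 * k.+1%:R.
  have N0 : 0 <= N by rewrite addr_ge0// mulr_ge0// ltW.
  have N1 : 0 < N + 1 by rewrite ltr_wpDl.
  pose h := Num.min 4^-1 (e / (N + 1)).
  have h0 : 0 < h by rewrite lt_min invr_gt0 ltr0n /= divr_gt0.
  have h4 : 4 * h <= 1 by rewrite -ler_pdivlMl// mulr1 ge_min lexx.
  have hN : h * N <= e.
    apply: (@le_trans _ _ (h * (N + 1))); first by rewrite ler_wpM2l ?(ltW h0)// lerDl.
    by rewrite -ler_pdivlMr// ge_min lexx orbT.
  have := admissible_close lmax0 qP h0.
  apply: (@filterS _ _ (nbhs_filter q)) => q' close q'P.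
  have [lens pts] := close q'P.
  have h4' : 0 <= 4 * h by rewrite mulr_ge0// ltW.
  have H1 := fid_near (adm_neq0 q qP) (adm_neq0 q' q'P) h4' h4 (adm_dist q' q'P) pts.
  have H2 : \sum_i (q i).1 <= \sum_i (q' i).1 + k.+1%:R * h.
    apply: le_trans (ler_sum _ (fun i _ => lens i)) _.
    by rewrite big_split/= sumr_const card_ord mulr_natl.
  rewrite /F /cost.
  have H := cost_step (lambda2 * (k.+1%:R - 1)) H1 H2 hN.
  exact: H.
have adm0 : @admissible R d M lmax k.+1 !=set0.
  exists (fun=> (0, fun=> 0)) => i; split => //=.
  - by rewrite in_itv/= lexx.
  - by move=> s t; rewrite subrr enorm0.
  - by move=> t j; rewrite mxE normr0.
have [q qP qmin] := compact_lsc_min adm0 (@compact_admissible R d M lmax k.+1) F_lsc.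
exists (F q); split; last first.
  move=> L f Ll f1 fM; apply: (qmin (fun i => (L i, f i))) => i.
  by split; [exact: Ll|exact: f1|exact: fM].
have L0 i : 0 <= (q i).1 by have [] := qP i; rewrite in_itv/= => /andP[].
have f1 i : nonexpansive ((q i).2 : R -> 'rV[R]_d) by have [] := qP i.
have [c cP] := nonexpansive_multicurve L0 f1.
pose g := @Multicurve R d k.+1 c isT.
have cl i : (curve_length (g i) <= ((q i).1)%:E)%E.
  have [cL cE] := cP i; rewrite -cL; apply: nonexpansive_curve_length.
  by rewrite cE.
exists g; have := @energy_le_cost _ _ mu mu_compact _ lambda2 _ hlambda1 p1 g _ cl.
suff -> : multicurve_image g = tracks (fun i => (q i).1) (fun i => (q i).2) by [].
apply: eq_bigcupr => i _; have [cL cE] := cP i.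
by rewrite /curve_image /= cL cE.
Qed.

Lemma minimizer_exists : exists g, is_minimizer mu p lambda1 lambda2 g.
Proof.
have [M M0 KM] := msupport_bounded mu_compact.
(* The cost of the origin alone is the reference: competitors above it are already beaten. Below it,
   [lmax] bounds each length and [N] the number of curves minus one. *)
pose E0 := cost mu lambda1 lambda2 p (tracks (fun _ : 'I_1 => 0) (fun _ _ => 0))
  (fun _ : 'I_1 => 0).
have E00 : 0 <= E0.
  apply: addr_ge0; first exact: fid_ge0.
  by rewrite big1// add0r subrr mulr0 mulr0.
pose lmax := E0 / lambda1.
have lmax0 : 0 <= lmax by rewrite divr_ge0// ltW.
have [r rP] := choice (fun k => fixed_number_minimum k M0 lmax0 KM).
have [N EN] : exists N : nat, E0 / (lambda1 * lambda2) < N%:R.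
  exists (Num.bound (E0 / (lambda1 * lambda2))); apply: archi_boundP.
  by rewrite divr_ge0// mulr_ge0// ltW.
have cube0 : in_cube M (0 : 'rV[R]_d) by move=> i; rewrite mxE normr0.
(* Here [r k] is the minimal cost with [k + 1] curves, so it remains to minimise over finitely many
   [k]. *)
case: (@arg_minP _ _ _ (ord0 : 'I_N.+1) xpredT (fun k : 'I_N.+1 => r k) isT).
move=> k _ kmin; have [[g gr] _] := rP k.
exists g => g'; apply: le_trans gr _.
have [g'E0|/ltW E0g'] := leP (energy mu p lambda1 lambda2 g') E0%:E; last first.
  apply: le_trans E0g'; rewrite lee_fin; apply: le_trans (kmin ord0 isT) _.
  apply: (rP ord0).2 => //; first by move=> i; rewrite in_itv/= lexx.
  by move=> i s t; rewrite subrr enorm0.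
have g'_fin : (energy mu p lambda1 lambda2 g' < +oo)%E.
  exact: le_lt_trans g'E0 (ltry _).
have [L [f [L0 Lg f1 fg]]] := arc_length_components mu_compact hlambda1 p1 g'_fin.
have cost_g' := @cost_le_energy _ _ mu mu_compact _ lambda2 _ hlambda1 p1 g' L Lg.
have [n nE] : exists n, ncurves g' = n.+1.
  by exists (ncurves g').-1; rewrite prednK// ncurves_gt0.
have := le_trans cost_g' g'E0; rewrite lee_fin => costE0.
apply: le_trans cost_g'; rewrite lee_fin.
have imgE : multicurve_image g' = tracks L f.
  by apply: eq_bigcup => // i _; rewrite fg.
rewrite imgE in costE0 *; clear imgE Lg fg g'_fin g'E0.
move: (ncurves g') nE L f L0 f1 costE0 => _ -> L f L0 f1 costE0.
have [SE nE] : lambda1 * \sum_i L i <= E0 /\ lambda1 * lambda2 * n%:R <= E0.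
  apply: cost_bounds (fid_ge0 (tracks L f)) _ _ _; first exact: sumr_ge0.
    exact: ler0n.
  by move: costE0; rewrite /cost (_ : n.+1%:R - 1 = n%:R)// -addn1 natrD addrK.
have Ll i : L i \in `[0, lmax].
  rewrite in_itv/= L0 /lmax ler_pdivlMr// mulrC; apply: le_trans SE.
  by rewrite ler_pM2l// (bigD1 i)//= lerDl sumr_ge0.
have nN : (n < N.+1)%N.
  rewrite ltnS -(ler_nat R) ltW//; apply: le_lt_trans EN.
  by rewrite ler_pdivlMr ?mulr_gt0// mulrC.
apply: le_trans (kmin (Ordinal nN) isT) _ => /=.
(* Truncation keeps the lengths [L] and the nonexpansiveness, and fixes the support, so no distance
   from the support increases. *)
pose f' i := cube_proj M \o f i.
have f'1 i : nonexpansive (f' i).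
  by move=> s t; apply: le_trans (cube_proj_lipschitz _ _ _) (f1 i s t).
have f'M i t : in_cube M (f' i t).
  have MM : - M <= M by rewrite (le_trans _ M0)// oppr_le0.
  by move=> j; rewrite mxE ler_norml; have := clamp_itv (f i t ord0 j) MM; rewrite in_itv.
apply: le_trans ((rP n).2 L f' Ll f'1 f'M) _.
have T0 := tracks_neq0 f L0; have T'0 := tracks_neq0 f' L0.
apply: lerD2r_imply.
apply: fine_le; [exact: fidelity_fin_num|exact: fidelity_fin_num|].
apply: le_fidelity => // x Kx; apply: le_dist_to => // _ [i _ [t tL <-]].
have xM : cube_proj M x = x.
  by apply: cube_proj_id => j; apply: le_trans (ler_coord_enorm x j) (KM x Kx).
apply: (@le_trans _ _ (enorm (x - f' i t))); last first.
  by rewrite -[in X in X <= _]xM; exact: cube_proj_lipschitz.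
by apply: dist_to_le; exists i => //; exists t.
Qed.

End Existence.

Theorem lemma2p2 (R : realType) (d : nat) (hd : (2 <= d)%N)
    (mu : {finite_measure set (borel_rV R d) -> \bar R})
    (mu_compact : compact (msupport mu))
    (mu_pos : (0 < mu setT)%E)
    (lambda1 lambda2 p : R)
    (hlambda1 : 0 < lambda1) (hlambda2 : 0 < lambda2) (hp : 1 <= p) :
  (exists g : multicurve R d, is_minimizer mu p lambda1 lambda2 g) /\
  (forall g : multicurve R d, is_minimizer mu p lambda1 lambda2 g ->
     multicurve_image g `<=` convex_hull (msupport mu)).
Proof.
split; first exact: minimizer_exists.
by move=> g; exact: minimizer_sub_hull.
Qed.
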